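(* Let $X$ be an oriented graph of bounded valency with a transition weight $w$, and let $T$ be its Bass operator on $H=\ell^2(E(X))$. Then $T$ is of trace class. The product $Z(u)=\prod_{c}\big(1-w(c)u^{\ell(c)}\big)^{-1}$, over all primitive cycles $c$ of $X$, converges for $|u|$ sufficiently small, and $Z(u)$ extends to a meromorphic function on $\mathbb{C}$; more precisely $Z(u)^{-1}$ is entire and $Z(u)^{-1}=\det(1-uT)$, where $\det$ is the Fredholm determinant.
   Context: An oriented graph $X$ consists of a set $N(X)$ of nodes and a set $E(X)\subset N(X)\times N(X)$ of oriented edges; for $e=(x,y)$, $s(e)=x$ is its source and $t(e)=y$ its target. The valency of a node is the number of edges having it as an endpoint; bounded valency means these are uniformly bounded. A transition weight is a map $w:E(X)\times E(X)\to[0,\infty)$ such that $w(e,f)\ne0$ implies $t(e)=s(f)$, and $\sum_{e,f\in E(X)}w(e,f)<\infty$. A closed path of length $n$ is a tuple $p=(e_1,\dots,e_n)$ of oriented edges with $t(e_j)=s(e_{j+1})$ for $j<n$ and $t(e_n)=s(e_1)$; its weight is $w(p)=w(e_1,e_2)w(e_2,e_3)\cdots w(e_{n-1},e_n)w(e_n,e_1)$. A cycle is an equivalence class of closed paths under cyclic shifts $(e_1,\dots,e_n)\sim(e_2,\dots,e_n,e_1)$; length $\ell(c)$ and weight $w(c)$ are defined on cycles. $c^k$ is the cycle $c$ traversed $k$ times. A cycle is primitive if it is not of the form $c_1^k$ with $k\ge2$. The Bass operator $T:H\to H$ on $H=\ell^2(E(X))$ (orthonormal basis $E(X)$) is $T(e)=\sum_{f\in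 E(X)}w(e,f)f$. *)

(* Defs.v *)
From HB Require Import structures.
From mathcomp Require Import all_boot all_order all_algebra finmap.
From mathcomp Require Import generic_quotient.
From mathcomp Require Import all_classical all_reals all_analysis.
From mathcomp.analysis Require Import summability.
From mathcomp Require Import complex.

Set Implicit Arguments.
Unset Strict Implicit.
Unset Printing Implicit Defensive.
Import Order.TTheory GRing.Theory Num.Theory.
Import numFieldNormedType.Exports.

Local Open Scope classical_set_scope.
Local Open Scope ring_scope.
Local Open Scope complex_scope.
Local Open Scope quotient_scope.

Record oriented_graph := OrientedGraph {
  node : choiceType;
  edges : set (node * node) }.
Arguments edges : clear implicits.

Definition edge (X : oriented_graph) : choiceType := set_type (edges X).

Definition source (X : oriented_graph) (e : edge X) : node X := (val e).1.
Definition target (X : oriented_graph) (e : edge X) : node X := (val e).2.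

Definition bounded_valency (X : oriented_graph) : Prop :=
  exists M : nat, forall x : node X,
    ([set e : edge X | source e = x \/ target e = x] #<= `I_M)%card.

Definition transition_weight (R : realType) (X : oriented_graph)
    (w : edge X -> edge X -> R) : Prop :=
  [/\ forall e f, 0 <= w e f,
      forall e f, w e f != 0 -> target e = source f &
      (\esum_(ef in [set: edge X * edge X]) (w ef.1 ef.2)%:E < +oo)%E].

Definition is_closed_path (X : oriented_graph) (p : seq (edge X)) : bool :=
  (p != [::]) && path.cycle (fun e f => target e == source f) p.

Definition closed_path (X : oriented_graph) : choiceType :=
  {p : seq (edge X) | is_closed_path p}.

Definition path_weight (R : realType) (X : oriented_graph)
    (w : edge X -> edge X -> R) (p : seq (edge X)) : R :=
  \prod_(ef <- zip p (rot 1 p)) w ef.1 ef.2.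

Definition cyclic_shift (X : oriented_graph) (p q : closed_path X) : bool :=
  `[< exists k : nat, val q = rot k (val p) >].

Lemma cyclic_shift_refl (X : oriented_graph) : reflexive (@cyclic_shift X).
Proof. by move=> p; apply/asboolP; exists 0; rewrite rot0. Qed.

Lemma cyclic_shift_sym (X : oriented_graph) : symmetric (@cyclic_shift X).
Proof.
suff H (p q : closed_path X) : cyclic_shift p q -> cyclic_shift q p.
  by move=> p q; apply/idP/idP; exact: H.
move=> /asboolP[k qE]; apply/asboolP.
by exists (size (val q) - k)%N; rewrite -/(rotr k (val q)) qE rotK.
Qed.

Lemma cyclic_shift_trans (X : oriented_graph) : transitive (@cyclic_shift X).
Proof.
move=> q p r /asboolP[k qE] /asboolP[l rE]; apply/asboolP.
rewrite rE qE.
have [kp|/ltnW/rot_oversize->] := leqP k (size (val p)); last by exists l.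
have [lp|lp] := leqP l (size (val p)).
  by rewrite rot_add_mod//; eexists.
by exists k; rewrite (@rot_oversize _ l)// size_rot ltnW.
Qed.

Canonical cyclic_shift_equiv (X : oriented_graph) :=
  EquivRel (@cyclic_shift X) (@cyclic_shift_refl X)
    (@cyclic_shift_sym X) (@cyclic_shift_trans X).

Definition gcycle (X : oriented_graph) : choiceType :=
  {eq_quot (@cyclic_shift_equiv X)}.

Definition cycle_of (X : oriented_graph) (p : closed_path X) : gcycle X :=
  \pi_({eq_quot (@cyclic_shift_equiv X)}) p.

Lemma cycle_ofP (X : oriented_graph) (p q : closed_path X) :
  reflect (exists k : nat, val q = rot k (val p)) (cycle_of p == cycle_of q).
Proof. by rewrite /cycle_of eqmodE; exact: asboolP. Qed.

Definition cycle_rep (X : oriented_graph) (c : gcycle X) : closed_path X :=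
  repr (c : {eq_quot (@cyclic_shift_equiv X)}).

Lemma cycle_repK (X : oriented_graph) : cancel (@cycle_rep X) (@cycle_of X).
Proof. by move=> c; rewrite /cycle_of /cycle_rep reprK. Qed.

Definition cycle_length (X : oriented_graph) (c : gcycle X) : nat :=
  size (val (cycle_rep c)).

Definition cycle_weight (R : realType) (X : oriented_graph)
    (w : edge X -> edge X -> R) (c : gcycle X) : R :=
  path_weight w (val (cycle_rep c)).

(* [path_pow p k] is p run through k times; the default of [insubd] is only
   reached for k = 0, see [val_path_pow]. *)
Definition path_pow (X : oriented_graph) (p : closed_path X) (k : nat)
    : closed_path X :=
  insubd p (flatten (nseq k (val p))).

Definition cycle_pow (X : oriented_graph) (c : gcycle X) (k : nat) : gcycle X :=
  cycle_of (path_pow (cycle_rep c) k).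

Definition primitive_cycle (X : oriented_graph) (c : gcycle X) : Prop :=
  ~ exists (c1 : gcycle X) (k : nat), (2 <= k)%N /\ c = cycle_pow c1 k.

Definition primitive_cycles (X : oriented_graph) : choiceType :=
  set_type [set c : gcycle X | primitive_cycle c].

Lemma cycle_length_of (X : oriented_graph) (p : closed_path X) :
  cycle_length (cycle_of p) = size (val p).
Proof.
have /eqP/cycle_ofP[k ->] := cycle_repK (cycle_of p).
by rewrite /cycle_length size_rot.
Qed.

Lemma path_weight_rot (R : realType) (X : oriented_graph)
    (w : edge X -> edge X -> R) (p : seq (edge X)) (k : nat) :
  path_weight w (rot k p) = path_weight w p.
Proof.
rewrite /path_weight.
have zip_rot (q r : seq (edge X)) : size q = size r ->
    perm_eq (zip (rot k q) (rot k r)) (zip q r).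
  move=> qr; rewrite /rot zip_cat ?size_drop ?qr// perm_catC.
  by rewrite -zip_cat ?cat_take_drop// !size_take qr.
by apply: perm_big; rewrite rot_rot; apply: zip_rot; rewrite size_rot.
Qed.

Lemma cycle_weight_of (R : realType) (X : oriented_graph)
    (w : edge X -> edge X -> R) (p : closed_path X) :
  cycle_weight w (cycle_of p) = path_weight w (val p).
Proof.
have /eqP/cycle_ofP[k ->] := cycle_repK (cycle_of p).
by rewrite path_weight_rot.
Qed.

Lemma val_path_pow (X : oriented_graph) (p : closed_path X) (k : nat) :
  (0 < k)%N -> val (path_pow p k) = flatten (nseq k (val p)).
Proof.
case: k => // k _; rewrite val_insubd ifT//.
case: p => -[//|e p]; rewrite /is_closed_path/= => pP.
rewrite rcons_path cat_path last_cat; move: pP; rewrite rcons_path.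
move=> /andP[ep pe]; rewrite ep/=.
by elim: k => [//|k IH] /=; rewrite cat_path last_cat pe ep.
Qed.

Lemma cycle_pow_of (X : oriented_graph) (p : closed_path X) (k : nat) :
  (0 < k)%N -> cycle_pow (cycle_of p) k = cycle_of (path_pow p k).
Proof.
move=> k0; apply/eqP/cycle_ofP; rewrite !val_path_pow//.
have /eqP/cycle_ofP[l ->] := cycle_repK (cycle_of p).
set q := val (cycle_rep _); exists (minn l (size q)).
have powC (a b : seq (edge X)) n :
    a ++ flatten (nseq n (b ++ a)) = flatten (nseq n (a ++ b)) ++ a.
  by elim: n => [|n IH] /=; rewrite ?cats0// -!catA IH.
have rot_pow (a b : seq (edge X)) n :
    flatten (nseq n.+1 (b ++ a)) = rot (size a) (flatten (nseq n.+1 (a ++ b))).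
  by rewrite /= -[in RHS]catA rot_size_cat -!catA powC.
have -> : minn l (size q) = size (take l q) by rewrite size_take_min.
by case: k k0 => // k _; rewrite {1}/rot rot_pow cat_take_drop.
Qed.

#[export] Existing Instance totally_filter.

(* Unordered sums, as limits of finite partial sums along finite subsets. *)
Definition has_sum (R : realType) (I : choiceType) (f : I -> R[i]) (s : R[i])
    : Prop :=
  partial_sum f @ totally --> (s : (R[i])^o).

Definition csum (R : realType) (I : choiceType) (f : I -> R[i]) : R[i] :=
  summability.sum (f : I -> (R[i])^o).

Definition sq_norm (R : realType) (E : choiceType) (phi : E -> R[i]) : \bar R :=
  \esum_(e in [set: E]) (ComplexField.Normc.normc (phi e) ^+ 2)%:E.

Definition l2 (R : realType) (E : choiceType) (phi : E -> R[i]) : Prop :=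
  (sq_norm phi < +oo)%E.

Definition l2_norm (R : realType) (E : choiceType) (phi : E -> R[i]) : R :=
  Num.sqrt (fine (sq_norm phi)).

Definition inner (R : realType) (E : choiceType) (phi psi : E -> R[i]) : R[i] :=
  csum (fun e => phi e * (psi e)^*%C).

Definition basis_vec (R : realType) (E : choiceType) (e : E) : E -> R[i] :=
  fun f => (f == e)%:R.

(* An operator on l^2(E) is a map on all functions E -> R[i]; only its restriction
   to the square-summable ones is meaningful. *)
Definition operator (R : realType) (E : choiceType) : Type :=
  (E -> R[i]) -> (E -> R[i]).

Definition bounded_operator (R : realType) (E : choiceType)
    (A : operator R E) : Prop :=
  (forall (a : R[i]) (phi psi : E -> R[i]), l2 phi -> l2 psi ->
     A (fun e => a * phi e + psi e) = (fun e => a * A phi e + A psi e)) /\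
  (exists M : R, forall phi : E -> R[i], l2 phi ->
     l2 (A phi) /\ l2_norm (A phi) <= M * l2_norm phi).

(* In the order of R[i], 0 <= z means that z is real and nonnegative. *)
Definition positive_operator (R : realType) (E : choiceType)
    (A : operator R E) : Prop :=
  bounded_operator A /\
  forall phi : E -> R[i], l2 phi -> 0 <= inner (A phi) phi.

Definition is_adjoint (R : realType) (E : choiceType)
    (A B : operator R E) : Prop :=
  bounded_operator B /\
  forall phi psi : E -> R[i], l2 phi -> l2 psi ->
    inner (A phi) psi = inner phi (B psi).

(* S = |A| = (A^* A)^(1/2) *)
Definition is_absolute_value (R : realType) (E : choiceType)
    (A S : operator R E) : Prop :=
  positive_operator S /\
  exists B : operator R E, is_adjoint A B /\
    forall phi : E -> R[i], l2 phi -> S (S phi) = B (A phi).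

Definition trace_class (R : realType) (E : choiceType)
    (A : operator R E) : Prop :=
  bounded_operator A /\
  exists S : operator R E, is_absolute_value A S /\
    exists t : R[i],
      has_sum (fun e => inner (S (basis_vec R e)) (basis_vec R e)) t.

(* Fredholm's series: d = det(1 + A) = \sum_k tr(\Lambda^k A), where
   tr(\Lambda^k A) is the sum of the principal k x k minors of the matrix of A,
   i.e. 1/k! times the sum over all k-tuples of indices. *)
Definition is_fredholm_det (R : realType) (E : choiceType)
    (A : operator R E) (d : R[i]) : Prop :=
  exists t : nat -> R[i],
    (forall k : nat,
       has_sum (fun s : k.-tuple E =>
         \det (\matrix_(i < k, j < k)
           inner (A (basis_vec R (tnth s i))) (basis_vec R (tnth s j))))
         (t k)) /\
    (\sum_(0 <= k < n) t k / (k`!)%:R @[n --> \oo] --> (d : (R[i])^o)).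

(* The continuous linear extension to l^2 of e |-> \sum_f w(e,f) f,
   see [bass_operator_basis]. *)
Definition bass_operator (R : realType) (X : oriented_graph)
    (w : edge X -> edge X -> R) : operator R (edge X) :=
  fun phi f => csum (fun e => phi e * (w e f)%:C).

Lemma has_sum_unique (R : realType) (I : choiceType) (f : I -> R[i]) (s : R[i]) :
  has_sum f s -> csum f = s.
Proof. by move=> fs; exact: (@cvg_lim (R[i])^o). Qed.

Lemma bass_operator_basis (R : realType) (X : oriented_graph)
    (w : edge X -> edge X -> R) (e f : edge X) :
  bass_operator w (basis_vec R e) f = (w e f)%:C.
Proof.
apply: has_sum_unique; apply: (@cvg_near_cst _ (R[i])^o).
exists [fset e]%fset => // A /=; rewrite fsub1set => eA.
rewrite /partial_sum (bigD1 [` eA]%fset)//= /basis_vec eqxx mul1r.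
rewrite big1 ?addr0// => i; rewrite -val_eqE/= => /negPf ->.
by rewrite mul0r.
Qed.

(* As usual for infinite products, convergence requires a nonzero limit. *)
Definition prod_converges_to (R : realType) (I : choiceType)
    (f : I -> R[i]) (z : R[i]) : Prop :=
  [/\ forall i, f i != 0, z != 0 &
      (\prod_(i <- A) f i) @[A --> (@totally I)] --> (z : (R[i])^o)].

Definition holomorphic_at (R : realType) (f : R[i] -> R[i]) (z : R[i]) : Prop :=
  derivable (f : (R[i])^o -> (R[i])^o) z 1.

Definition entire (R : realType) (f : R[i] -> R[i]) : Prop :=
  forall z : R[i], holomorphic_at f z.

(* At every point f has at most a pole; the value of f at the point itself is
   irrelevant. *)
Definition meromorphic (R : realType) (f : R[i] -> R[i]) : Prop :=
  forall p : R[i], exists (n : nat) (g : R[i] -> R[i]),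
    (\forall z \near (p : (R[i])^o), holomorphic_at g z) /\
    (\forall z \near (p : (R[i])^o)^', f z = g z / (z - p) ^+ n).

Definition zeta_factor (R : realType) (X : oriented_graph)
    (w : edge X -> edge X -> R) (u : R[i]) (c : primitive_cycles X) : R[i] :=
  (1 - (cycle_weight w (val c))%:C * u ^+ cycle_length (val c))^-1.

(* Main.v *)
(** Write W for the sum of all weights. Fredholm's series gives
    D(u) = det(1 - uT) = sum_n d_n u^n. Since |det| is at most the product of
    the row sums, |d_n| <= W^n / n!, so D is entire; as D(0) = 1, re-expanding D
    at any point p gives a nonzero power series, hence 1/D has at most poles.

    Expanding bordered determinants along a row yields Newton's identity
    n d_n = - sum_(1 <= k <= n) tau_k d_(n-k), where tau_k is the sum of the
    weights of all closed paths of length k. For a finite set A of primitive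
    cycles, the coefficients of prod_(c in A) (1 - w(c) u^l(c)) satisfy the same
    recursion with tau_k replaced by the sum p_k(A) of l(c) w(c)^(k / l(c)) over
    the c in A with l(c) | k. A closed path of length k is a unique power of a
    primitive one, so p_k(A) is a partial sum of tau_k. Therefore p_k(A) tends to
    tau_k, the coefficients converge to those of D, and they are all bounded by
    W^n, so the products converge to D(u) if W |u| < 1; and D(u) does not vanish
    if W |u| < 1/2.

    The absolute value S of T is c (1 - Y) with c > |T| and Y the limit of
    Y_(n+1) = (1 - T^* T / c^2 + Y_n^2) / 2. Its trace is finite because
    <S e, e> <= |S e| = |T e| <= sum_f w(e, f). *)

Require Import Defs.
From HB Require Import structures.
From mathcomp Require Import all_boot all_order all_algebra finmap.
From mathcomp Require Import all_classical all_reals all_analysis.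
From mathcomp Require Import complex.
From mathcomp Require Import perm ring lra zify.
From mathcomp.analysis Require Import summability.
Import Order.TTheory GRing.Theory Num.Theory.
Import numFieldNormedType.Exports.
Local Open Scope classical_set_scope.
Local Open Scope ring_scope.
Local Open Scope complex_scope.

Set Implicit Arguments.
Unset Strict Implicit.
Unset Printing Implicit Defensive.

(** Newton's recursion takes the place of logarithms and exponentials: after division by n it
    determines the n-th coefficient from the earlier ones and the power sums, so convergence along
    finite sets of cycles and the bound W^n both pass through it by induction on n. No logarithm of
    a determinant or of an infinite product has to be defined. The edge set may be infinite.
    Identities between determinants and closed paths are therefore proved for a finite set of edges
    and passed to the limit; the sums of absolute values over k-tuples are at most W^k whatever the
    finite set, so these limits exist. The same W bounds T, because the l^2 norm is at most the l^1
    norm. The square root of T^* T comes from an explicit iteration controlled by a scalar one,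
    which replaces the spectral theorem. *)

Local Notation nc := ComplexField.Normc.normc.

(** * Complex moduli and limits *)

Section ComplexModulus.
Context {R : realType}.
Implicit Types (x y z : R[i]) (a : R).

Lemma normr_nc z : `|z| = (nc z)%:C. Proof. by case: z. Qed.

Lemma real_complex_inj a b : a%:C = b%:C :> R[i] -> a = b.
Proof. by case. Qed.

Lemma nc_real a : nc (a%:C : R[i]) = `|a|.
Proof. by rewrite /= expr0n addr0 sqrtr_sqr. Qed.

Lemma nc_ge0 z : 0 <= nc z.
Proof. by case: z => a b; exact: sqrtr_ge0. Qed.

Lemma ncD x y : nc (x + y) <= nc x + nc y.
Proof. exact: le_normcD. Qed.

Lemma ncM x y : nc (x * y) = nc x * nc y.
Proof. exact: ComplexField.Normc.normcM. Qed.

Lemma ncN x : nc (- x) = nc x.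
Proof. exact: normcN. Qed.

Lemma nc0 : nc (0 : R[i]) = 0. Proof. exact: ComplexField.Normc.normc0. Qed.

Lemma nc1 : nc (1 : R[i]) = 1. Proof. exact: ComplexField.Normc.normc1. Qed.

Lemma ncB x y : nc (x - y) <= nc x + nc y.
Proof. by rewrite -(ncN y) ncD. Qed.

Lemma nc_distrC x y : nc (x - y) = nc (y - x).
Proof. by rewrite -ncN opprB. Qed.

Lemma ncX x n : nc (x ^+ n) = nc x ^+ n.
Proof. by elim: n => [|n IH]; rewrite ?expr0 ?nc1// !exprS ncM IH. Qed.

Lemma ncV x : nc x^-1 = (nc x)^-1.
Proof. exact: ComplexField.Normc.normcV. Qed.

Lemma nc_eq0 x : (nc x == 0) = (x == 0).
Proof.
by apply/eqP/eqP => [/ComplexField.Normc.eq0_normc//|->]; exact: nc0.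
Qed.

Lemma nc_conj z : nc z^*%C = nc z.
Proof. by case: z => a b /=; rewrite sqrrN. Qed.

Lemma nc_nat n : nc (n%:R : R[i]) = n%:R.
Proof. by rewrite -(rmorph_nat (real_complex R)) nc_real ger0_norm. Qed.

Lemma nc_sum (I : Type) (s : seq I) (P : pred I) (f : I -> R[i]) :
  nc (\sum_(i <- s | P i) f i) <= \sum_(i <- s | P i) nc (f i).
Proof.
elim/big_ind2: _ => [|x1 x2 y1 y2 h1 h2|//]; first by rewrite nc0.
exact: le_trans (ncD _ _) (lerD h1 h2).
Qed.

Lemma nc_prod (I : Type) (s : seq I) (P : pred I) (f : I -> R[i]) :
  nc (\prod_(i <- s | P i) f i) = \prod_(i <- s | P i) nc (f i).
Proof.
elim/big_ind2: _ => [|x1 x2 y1 y2 h1 h2|//]; first by rewrite nc1.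
by rewrite ncM h1 h2.
Qed.

Lemma nc_ge_Re z : `|complex.Re z| <= nc z.
Proof.
case: z => a b /=; rewrite -sqrtr_sqr ler_sqrt ?addr_ge0 ?sqr_ge0//.
by rewrite lerDl sqr_ge0.
Qed.

Lemma nc_ge_Im z : `|complex.Im z| <= nc z.
Proof.
case: z => a b /=; rewrite -sqrtr_sqr ler_sqrt ?addr_ge0 ?sqr_ge0//.
by rewrite lerDr sqr_ge0.
Qed.

Lemma nc_sqr z : (nc z ^+ 2)%:C = z * z^*%C.
Proof. by rewrite -sqr_normc normr_nc rmorphXn. Qed.

Lemma nc_near_eq0 z : (forall e, 0 < e -> nc z <= e) -> z = 0.
Proof.
move=> h; apply/eqP; rewrite -nc_eq0 eq_le nc_ge0 andbT.
by apply/ler_addgt0Pr => e e0; rewrite add0r h.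
Qed.

End ComplexModulus.

Section ComplexLimits.
Context {R : realType}.

(** Convergence with real radii: the norm of [R[i]] takes its values in [R[i]], which is awkward for
    estimates. *)
Definition cvgc (T : Type) (F : set_system T) (f : T -> R[i]) (s : R[i]) : Prop :=
  forall e : R, 0 < e -> \forall x \near F, nc (f x - s) < e.

Section Limits.
Context {T : Type} {F : set_system T} {FF : Filter F}.
Implicit Types (f g : T -> R[i]) (s t : R[i]).

Lemma cvgcP f s : f @ F --> (s : (R[i])^o) <-> cvgc F f s.
Proof.
split=> [/(@cvgrPdist_lt _ (R[i])^o) h e e0|h].
  have := h e%:C; rewrite ltcR => /(_ e0).
  by apply: filterS => x; rewrite normr_nc ltcR nc_distrC.
(* A positive element of [R[i]] is real, so a complex radius is a real one. *)
apply/(@cvgrPdist_lt _ (R[i])^o) => -[a b]; rewrite ltcE /= => /andP[/eqP -> a0].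
by have := h a a0; apply: filterS => x; rewrite normr_nc ltcR nc_distrC.
Qed.

Lemma cvgc_cst s : cvgc F (fun=> s) s.
Proof. by move=> e e0; apply: nearW => x; rewrite subrr nc0. Qed.

Lemma eq_cvgc f g s : f =1 g -> cvgc F f s -> cvgc F g s.
Proof. by move=> /funext ->. Qed.

Lemma cvgcD f g s t : cvgc F f s -> cvgc F g t ->
  cvgc F (fun x => f x + g x) (s + t).
Proof.
move=> fs gt e e0; have e2 : 0 < e / 2 by rewrite divr_gt0.
have := fs _ e2; have := gt _ e2; apply: filterS2 => x h1 h2.
rewrite opprD addrACA; apply: le_lt_trans (ncD _ _) _.
by rewrite [e]splitr ltrD.
Qed.

Lemma cvgcM f g s t : cvgc F f s -> cvgc F g t ->
  cvgc F (fun x => f x * g x) (s * t).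
Proof.
move=> fs gt e e0; pose k : R := 1 + nc s + nc t.
(* Once both differences are below d <= 1, the error is less than d (1 + |s| + |t|) = d k. *)
have k0 : 0 < k by rewrite /k -addrA ltr_pwDl ?addr_ge0 ?nc_ge0.
pose d : R := Num.min 1 (e / k).
have d0 : 0 < d by rewrite lt_min ltr01 divr_gt0.
have := fs _ d0; have := gt _ d0; apply: filterS2 => x h1 h2.
have -> : f x * g x - s * t =
  (f x - s) * (g x - t) + (s * (g x - t) + t * (f x - s)) by ring.
have dk : d * k <= e.
  by rewrite -(@mulfVK _ k _ e) ?gt_eqF// ler_pM2r// ge_min lexx orbT.
have d1 : d <= 1 by rewrite ge_min lexx.
have [p0 q0] := (nc_ge0 (f x - s), nc_ge0 (g x - t)).
apply: le_lt_trans (ncD _ _) _; rewrite ncM.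
apply: (@lt_le_trans _ _ (d + (nc s * d + nc t * d))); last first.
  by apply: le_trans dk; rewrite /k le_eqVlt; apply/orP; left; apply/eqP; ring.
apply: ltr_leD.
  apply: le_lt_trans h2; rewrite -[leRHS]mulr1 ler_wpM2l//.
  exact: le_trans (ltW h1) d1.
apply: le_trans (ncD _ _) _; rewrite !ncM.
by apply: lerD; rewrite ler_wpM2l ?nc_ge0// ltW.
Qed.

Lemma cvgcZ a f s : cvgc F f s -> cvgc F (fun x => a * f x) (a * s).
Proof. exact: cvgcM (cvgc_cst a). Qed.

Lemma cvgcN f s : cvgc F f s -> cvgc F (fun x => - f x) (- s).
Proof.
move=> /(cvgcZ (-1)); rewrite mulN1r; apply: eq_cvgc => x; exact: mulN1r.
Qed.

Lemma cvgc_sum (K : Type) (l : seq K) (P : pred K) (f : K -> T -> R[i])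
    (s : K -> R[i]) : (forall k, P k -> cvgc F (f k) (s k)) ->
  cvgc F (fun x => \sum_(k <- l | P k) f k x) (\sum_(k <- l | P k) s k).
Proof.
move=> h; elim: l => [|k l IH].
  rewrite big_nil; apply: eq_cvgc (cvgc_cst 0) => x; by rewrite big_nil.
rewrite big_cons; case: ifPn => Pk.
  by apply: eq_cvgc (cvgcD (h k Pk) IH) => x; rewrite big_cons Pk.
by apply: eq_cvgc IH => x; rewrite big_cons (negPf Pk).
Qed.

Lemma cvgcV f s : s != 0 -> cvgc F f s -> cvgc F (fun x => (f x)^-1) s^-1.
Proof.
move=> s0 fs e e0; have n0 : 0 < nc s by rewrite lt_neqAle eq_sym nc_eq0 s0 nc_ge0.
(* The first bound keeps |f x| >= |s| / 2; the second then makes |f x - s| / (|f x| |s|) less than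
   e. *)
pose d : R := Num.min (nc s / 2) (e * nc s * nc s / 2).
have d0 : 0 < d by rewrite lt_min !divr_gt0 ?mulr_gt0.
have := fs _ d0; apply: filterS => x; rewrite lt_min => /andP[h1 h2].
have h3 : nc s / 2 <= nc (f x).
  have : nc s <= nc (f x) + nc (f x - s).
    by rewrite {1}(_ : s = f x - (f x - s)) ?ncB//; ring.
  move: h1; lra.
have fx0 : 0 < nc (f x) by rewrite (lt_le_trans _ h3)// divr_gt0.
have f0 : f x != 0 by rewrite -nc_eq0 gt_eqF.
have -> : (f x)^-1 - s^-1 = - ((f x - s) * (f x)^-1 * s^-1).
  by field; rewrite s0 f0.
rewrite ncN !ncM !ncV ltr_pdivrMr// ltr_pdivrMr//.
have : e * nc s * (nc s / 2) <= e * nc s * nc (f x).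
  by rewrite ler_wpM2l// mulr_ge0 ?nc_ge0// ltW.
by rewrite mulrA; exact: lt_le_trans h2.
Qed.

End Limits.

Lemma cvgc_le (T : Type) (F : set_system T) {FF : ProperFilter F}
    (f : T -> R[i]) (s : R[i]) (M : R) :
  cvgc F f s -> (\forall x \near F, nc (f x) <= M) -> nc s <= M.
Proof.
move=> fs fM; apply/ler_addgt0Pr => e /fs he.
have [x [h1 h2]] := filter_ex (filterI fM he).
have -> : s = f x - (f x - s) by ring.
apply: le_trans (ncB _ _) _; exact: lerD h1 (ltW h2).
Qed.

Lemma cvgc_unique (T : Type) (F : set_system T) {FF : ProperFilter F}
    (f : T -> R[i]) (s t : R[i]) : cvgc F f s -> cvgc F f t -> s = t.
Proof.
move=> fs ft; apply/eqP; rewrite -subr_eq0; apply/eqP/nc_near_eq0 => e e0.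
have h : cvgc F (fun x => f x - f x) (s - t).
  by apply: cvgcD => //; exact: cvgcN.
apply: (cvgc_le h); apply: nearW => x; by rewrite subrr nc0 ltW.
Qed.

End ComplexLimits.

(** * Unordered sums *)

Section FiniteSums.
Context {R : numDomainType} {I : eqType}.

Lemma ler_sum_sub (s t : seq I) (g : I -> R) : uniq s -> uniq t ->
  {subset s <= t} -> (forall i, 0 <= g i) ->
  \sum_(i <- s) g i <= \sum_(i <- t) g i.
Proof.
move=> us ut st g0; rewrite [leRHS](bigID (mem s)) /=.
rewrite -[X in _ <= X + _]big_filter.
rewrite [X in X <= _](perm_big [seq i <- t | i \in s]); last first.
  apply: uniq_perm; rewrite ?filter_uniq// => i; rewrite mem_filter.
  by case: (boolP (i \in s)) => // /st ->.
by rewrite lerDl sumr_ge0.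
Qed.

End FiniteSums.

Section UnorderedSums.
Context {R : realType}.

(** Absolute summability with an explicit bound, tested on duplicate-free lists: no extended reals
    occur, and injective maps and filters act directly on the test lists. *)
Definition bsum {I : eqType} (f : I -> R[i]) (M : R) : Prop :=
  forall s : seq I, uniq s -> \sum_(i <- s) nc (f i) <= M.

Definition asum {I : eqType} (f : I -> R[i]) : Prop := exists M, bsum f M.

Lemma bsum_ge0 {I : eqType} (f : I -> R[i]) M : bsum f M -> 0 <= M.
Proof. by move=> /(_ [::] isT); rewrite big_nil. Qed.

Lemma bsum1 {I : eqType} (f : I -> R[i]) M : bsum f M -> forall i, nc (f i) <= M.
Proof. by move=> h i; have := h [:: i] isT; rewrite big_seq1. Qed.

Lemma le_bsum {I : eqType} (f g : I -> R[i]) M :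
  (forall i, nc (f i) <= nc (g i)) -> bsum g M -> bsum f M.
Proof. by move=> fg gM s us; apply: le_trans (gM s us); exact: ler_sum. Qed.

Lemma bsumZ {I : eqType} (f : I -> R[i]) a M :
  bsum f M -> bsum (fun i => a * f i) (nc a * M).
Proof.
move=> fM s us; under eq_bigr do rewrite ncM.
by rewrite -mulr_sumr ler_wpM2l ?nc_ge0 ?fM.
Qed.

Lemma asumZ {I : eqType} (f : I -> R[i]) a : asum f -> asum (fun i => a * f i).
Proof. by move=> [M fM]; exists (nc a * M); exact: bsumZ. Qed.

Lemma bsum_inj {I J : eqType} (e : I -> J) (f : J -> R[i]) M :
  injective e -> bsum f M -> bsum (fun i => f (e i)) M.
Proof.
by move=> ie fM s us; have := fM (map e s); rewrite map_inj_uniq// big_map; exact.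
Qed.

Lemma partial_sumE {I : choiceType} (f : I -> R[i]) (A : {fset I}) :
  partial_sum f A = \sum_(i <- A) f i.
Proof. by rewrite big_seq_fsetE. Qed.

Lemma has_sumE {I : choiceType} (f : I -> R[i]) s :
  has_sum f s <-> cvgc totally (fun A : {fset I} => \sum_(i <- A) f i) s.
Proof.
rewrite /has_sum cvgcP (_ : partial_sum f = fun A => \sum_(i <- A) f i)//.
by apply/funext => A; rewrite partial_sumE.
Qed.

Lemma has_sumP {I : choiceType} (f : I -> R[i]) s :
  has_sum f s <-> forall e : R, 0 < e -> exists A0 : {fset I},
    forall A : {fset I}, (A0 `<=` A)%fset -> nc (\sum_(i <- A) f i - s) < e.
Proof.
rewrite has_sumE; split=> [h e e0|h e e0].
  by have [A0 _ hA] := h _ e0; exists A0 => A A0A; exact: hA.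
by have [A0 hA] := h _ e0; exists A0 => // A /= A0A; exact: hA.
Qed.

Lemma eq_has_sum {I : choiceType} (f g : I -> R[i]) s :
  f =1 g -> has_sum f s -> has_sum g s.
Proof. by move=> /funext ->. Qed.

Lemma has_sumD {I : choiceType} (f g : I -> R[i]) s t :
  has_sum f s -> has_sum g t -> has_sum (fun i => f i + g i) (s + t).
Proof.
move=> /has_sumE fs /has_sumE gt; apply/has_sumE.
by apply: eq_cvgc (cvgcD fs gt) => A; rewrite big_split.
Qed.

Lemma has_sumZ {I : choiceType} (f : I -> R[i]) a s :
  has_sum f s -> has_sum (fun i => a * f i) (a * s).
Proof.
move=> /has_sumE fs; apply/has_sumE.
by apply: eq_cvgc (cvgcZ a fs) => A; rewrite mulr_sumr.
Qed.

#[global] Arguments has_sumZ {I f} a {s}.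

Lemma has_sumN {I : choiceType} (f : I -> R[i]) s :
  has_sum f s -> has_sum (fun i => - f i) (- s).
Proof.
move=> /(has_sumZ (-1)); rewrite mulN1r; apply: eq_has_sum => i.
by rewrite mulN1r.
Qed.

Lemma has_sumB {I : choiceType} (f g : I -> R[i]) s t :
  has_sum f s -> has_sum g t -> has_sum (fun i => f i - g i) (s - t).
Proof. by move=> fs /has_sumN; exact: has_sumD. Qed.

Lemma has_sum_conj {I : choiceType} (f : I -> R[i]) s :
  has_sum f s -> has_sum (fun i => (f i)^*%C) (s^*%C).
Proof.
move=> /has_sumP h; apply/has_sumP => e /h[A0 hA]; exists A0 => A /hA.
by rewrite -rmorph_sum -rmorphB nc_conj.
Qed.

Lemma has_sum_le {I : choiceType} (f : I -> R[i]) s M :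
  has_sum f s -> bsum f M -> nc s <= M.
Proof.
move=> /has_sumP h fM; apply/ler_addgt0Pr => e /h[A0 /(_ A0 (fsubset_refl _))].
set S := \sum_(i <- A0) _ => hS; have -> : s = S - (S - s) by ring.
apply: le_trans (ncB _ _) _; apply: lerD (ltW hS).
by apply: le_trans (nc_sum _ _ _) (fM _ (fset_uniq _)).
Qed.

Lemma has_sum_singleton {I : choiceType} (f : I -> R[i]) i :
  (forall j, j != i -> f j = 0) -> has_sum f (f i).
Proof.
move=> h; apply/has_sumP => e e0; exists [fset i]%fset => A; rewrite fsub1set => iA.
rewrite (big_fsetD1 i)//= big_seq big1 ?addr0 ?subrr ?nc0// => j.
by rewrite in_fsetD1 => /andP[/h].
Qed.

Lemma nonneg_has_sum {I : choiceType} (g : I -> R) M :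
  (forall i, 0 <= g i) ->
  (forall s : seq I, uniq s -> \sum_(i <- s) g i <= M) ->
  exists s, has_sum (fun i => (g i)%:C) s%:C.
Proof.
move=> g0 gM; pose E := [set \sum_(i <- (A : {fset I})) g i | A in setT].
have E0 : E !=set0 by exists (\sum_(i <- fset0) g i); exists fset0.
have uE : has_ubound E by exists M => _ [A _ <-]; exact: gM.
exists (sup E); apply/has_sumP => e e0.
have [_ [A0 _ <-] hA0] := sup_adherent e0 (conj E0 uE).
exists A0 => A A0A; rewrite -rmorph_sum -rmorphB nc_real.
have h1 : \sum_(i <- A0) g i <= \sum_(i <- A) g i.
  by apply: ler_sum_sub => //; exact/fsubsetP.
have h2 : \sum_(i <- A) g i <= sup E by apply: ub_le_sup => //; exists A.
by rewrite ler0_norm ?subr_le0// opprB ltrBlDr -ltrBlDl (lt_le_trans hA0).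
Qed.

(** Reduction to nonnegative families: [g + q] and [q] are nonnegative with bounded finite sums, and
    [g] is their difference. *)
Lemma dominated_has_sum {I : choiceType} (g q : I -> R) M :
  (forall i, `|g i| <= q i) ->
  (forall s : seq I, uniq s -> \sum_(i <- s) q i <= M) ->
  exists s, has_sum (fun i => (g i)%:C) s%:C.
Proof.
move=> gq qM.
have [s hs] : exists s, has_sum (fun i => (g i + q i)%:C) s%:C.
  apply: (@nonneg_has_sum _ _ (M + M)) => [i|s us].
    by move: (gq i); rewrite ler_norml => /andP[]; lra.
  rewrite big_split; apply: lerD (qM _ us); apply: le_trans (qM _ us).
  by apply: ler_sum => i _; exact: le_trans (ler_norm _) (gq _).
have [t ht] : exists t, has_sum (fun i => (q i)%:C) t%:C.
  by apply: (@nonneg_has_sum _ _ M) => // i; exact: le_trans (normr_ge0 _) (gq i).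
exists (s - t); rewrite rmorphB; apply: eq_has_sum (has_sumB hs ht) => i.
by rewrite -rmorphB addrK.
Qed.

Lemma asum_has_sum {I : choiceType} (f : I -> R[i]) :
  asum f -> has_sum f (csum f).
Proof.
move=> [M fM].
have [s hs] := dominated_has_sum (fun i => nc_ge_Re (f i)) fM.
have [t ht] := dominated_has_sum (fun i => nc_ge_Im (f i)) fM.
have h : has_sum f (s%:C + (0 +i* 1) * t%:C).
  apply: eq_has_sum (has_sumD hs (has_sumZ (0 +i* 1) ht)) => i.
  by case: (f i) => a b /=; simpc.
by rewrite (has_sum_unique h).
Qed.

Lemma csumD {I : choiceType} (f g : I -> R[i]) : asum f -> asum g ->
  csum (fun i => f i + g i) = csum f + csum g.
Proof.
move=> fa ga; apply: has_sum_unique; apply: has_sumD; exact: asum_has_sum.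
Qed.

Lemma csumZ {I : choiceType} (f : I -> R[i]) a : asum f ->
  csum (fun i => a * f i) = a * csum f.
Proof. by move=> fa; apply: has_sum_unique; apply: has_sumZ; exact: asum_has_sum. Qed.

Lemma csum_conj {I : choiceType} (f : I -> R[i]) : asum f ->
  csum (fun i => (f i)^*%C) = (csum f)^*%C.
Proof. by move=> fa; apply: has_sum_unique; apply: has_sum_conj; exact: asum_has_sum. Qed.

Lemma csum_le {I : choiceType} (f : I -> R[i]) M : bsum f M -> nc (csum f) <= M.
Proof. by move=> fM; apply: (@has_sum_le _ f) => //; apply: asum_has_sum; exists M. Qed.

Lemma has_sum_reindex {I J : choiceType} (e : I -> J) (e' : J -> I)
    (f : J -> R[i]) s : cancel e e' -> cancel e' e ->
  has_sum f s -> has_sum (fun i => f (e i)) s.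
Proof.
move=> ek e'k /has_sumP h; apply/has_sumP => d /h[A0 hA].
exists (e' @` A0)%fset => A A0A.
have <- : \sum_(j <- (e @` A)%fset) f j = \sum_(i <- A) f (e i).
  by rewrite big_imfset//= => x y _ _; exact: can_inj ek _ _.
apply: hA; apply/fsubsetP => j jA0; apply/imfsetP; exists (e' j) => //=.
by apply: (fsubsetP A0A); apply/imfsetP; exists j.
Qed.

Lemma has_sum_big {I : choiceType} (K : Type) (l : seq K)
    (F : K -> I -> R[i]) (s : K -> R[i]) :
  (forall k, has_sum (F k) (s k)) ->
  has_sum (fun i => \sum_(k <- l) F k i) (\sum_(k <- l) s k).
Proof.
move=> h; elim: l => [|k l IH].
  rewrite big_nil; apply/has_sumP => e e0; exists fset0 => A _.
  by rewrite big1 ?subrr ?nc0// => i _; rewrite big_nil.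
rewrite big_cons; apply: eq_has_sum (has_sumD (h k) IH) => i.
by rewrite big_cons.
Qed.

#[global] Arguments has_sum_big {I K} l {F s}.

(** For a finite set A of rows large enough, a finite set B of columns is chosen after A. The sum
    over the rectangle of A and B is then within e/2 of the total, and within e/2 of the complete
    row sums over A. *)
Lemma fubini_has_sum {I J : choiceType} (h : I * J -> R[i]) :
  asum h -> has_sum (fun i => csum (fun j => h (i, j))) (csum h).
Proof.
move=> ha; have [M hM] := ha; apply/has_sumP => e e0.
have e2 : 0 < e / 2 by rewrite divr_gt0.
have [A0 hA0] := (has_sumP _ _).1 (asum_has_sum ha) _ e2.
exists (fst @` A0)%fset => A A0A.
have row i : has_sum (fun j => h (i, j)) (csum (fun j => h (i, j))).
  apply: asum_has_sum; exists M; apply: (@bsum_inj _ _ (fun j => (i, j)) h) => //.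
  by move=> x y [].
have [J0 hJ0] := (has_sumP _ _).1 (has_sum_big A row) _ e2.
set B := (J0 `|` snd @` A0)%fset.
have /hJ0 h1 : (J0 `<=` B)%fset by rewrite fsubsetUl.
pose AB := [fset ((i, j) : I * J) | i in A, j in B]%fset.
have /hA0 : (A0 `<=` AB)%fset.
  apply/fsubsetP => -[i j] ij; apply/imfset2P; exists i => /=.
    by apply: (fsubsetP A0A); apply/imfsetP; exists (i, j).
  exists j => //=; rewrite in_fsetU; apply/orP; right.
  by apply/imfsetP; exists (i, j).
rewrite /AB big_imfset2/=; last by move=> [x y] [x' y'] _ _ /= [-> ->].
rewrite exchange_big /= => h2.
set u := \sum_(i <- A) _ in h1 *.
set v := \sum_(j <- B) _ in h1 h2.
have -> : u - csum h = (v - csum h) - (v - u) by ring.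
by apply: le_lt_trans (ncB _ _) _; rewrite [e]splitr ltrD.
Qed.

Lemma fubini_has_sum_swap {I J : choiceType} (h : I * J -> R[i]) :
  asum h -> has_sum (fun j => csum (fun i => h (i, j))) (csum h).
Proof.
move=> ha; pose sw (A B : choiceType) (p : A * B) := (p.2, p.1).
have ha' : asum (fun p : J * I => h (sw _ _ p)).
  have [M hM] := ha; exists M; apply: bsum_inj hM; by move=> [a b] [c d] [-> ->].
have := fubini_has_sum ha'.
rewrite (@has_sum_unique _ _ (fun p : J * I => h (sw _ _ p)) (csum h))//.
by apply: (@has_sum_reindex _ _ (sw J I) (sw I J) h);
  [move=> []|move=> []|exact: asum_has_sum].
Qed.

Lemma csum_fubini {I J : choiceType} (h : I -> J -> R[i]) :
  asum (fun p : I * J => h p.1 p.2) ->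
  csum (fun i => csum (fun j => h i j)) = csum (fun j => csum (fun i => h i j)).
Proof.
move=> ha; rewrite (has_sum_unique (fubini_has_sum ha)).
by rewrite (has_sum_unique (fubini_has_sum_swap ha)).
Qed.

Lemma has_sum_series (f : nat -> R[i]) s :
  has_sum f s -> \sum_(0 <= k < n) f k @[n --> \oo] --> (s : (R[i])^o).
Proof.
move=> /has_sumP h; apply/cvgcP => e /h[A0 hA].
exists (\max_(i <- A0) i).+1 => // n /= hn.
have := hA [fset x in iota 0 n]%fset.
rewrite (perm_big (iota 0 n)) /=; last first.
  apply: uniq_perm; rewrite ?iota_uniq ?fset_uniq// => i.
  by rewrite !inE.
rewrite /index_iota subn0; apply; apply/fsubsetP => i iA.
rewrite !inE mem_iota add0n; apply: leq_trans hn; rewrite ltnS.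
exact: leq_bigmax_seq.
Qed.

End UnorderedSums.

(** * Entire power series *)

Section DoubleSums.
Context {R : realType}.

(** The test list is grouped by first coordinate; within a group the second coordinates are
    distinct, so the row bound applies. *)
Lemma bsum_pair {I J : choiceType} (h : I * J -> R[i]) (m : I -> R) (M : R) :
  (forall i, bsum (fun j => h (i, j)) (m i)) ->
  (forall s : seq I, uniq s -> \sum_(i <- s) m i <= M) -> bsum h M.
Proof.
move=> hm mM s us.
have -> : \sum_(p <- s) nc (h p) = \sum_(p <- [fset x in s]%fset) nc (h p).
  by apply: perm_big; apply: uniq_perm; rewrite ?fset_uniq// => p; rewrite !inE.
rewrite (partition_big_imfset _ fst) /=.
apply: le_trans (mM _ (fset_uniq _)); apply: ler_sum => i _.
rewrite -big_filter; set r := [seq _ <- _ | _].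
have ur : uniq r by rewrite filter_uniq// fset_uniq.
have -> : \sum_(p <- r) nc (h p) = \sum_(j <- map snd r) nc (h (i, j)).
  rewrite big_map; apply: eq_big_seq => -[a b]; rewrite mem_filter /=.
  by case/andP => /eqP ->.
apply: hm; rewrite map_inj_in_uniq// => -[a b] [c d]; rewrite !mem_filter /=.
by case/andP => /eqP -> _ /andP[/eqP -> _] ->.
Qed.

Lemma has_sum_fin {I : choiceType} (f : I -> R[i]) (s : seq I) :
  uniq s -> (forall i, i \notin s -> f i = 0) -> has_sum f (\sum_(i <- s) f i).
Proof.
move=> us fs; apply/has_sumP => e e0; exists [fset x in s]%fset => A sA.
have -> : \sum_(i <- s) f i = \sum_(i <- [fset x in s]%fset) f i.
  by apply: perm_big; apply: uniq_perm; rewrite ?fset_uniq// => p; rewrite !inE.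
rewrite (big_fset_incl _ sA) ?subrr ?nc0// => x _; rewrite !inE; exact: fs.
Qed.

Lemma geometric_sum_le (q : R) (s : seq nat) : 0 <= q < 1 -> uniq s ->
  \sum_(n <- s) q ^+ n <= (1 - q)^-1.
Proof.
move=> /andP[q0 q1] us; pose N := (\max_(i <- s) i).+1.
apply: (@le_trans _ _ (\sum_(n <- iota 0 N) q ^+ n)).
  apply: ler_sum_sub; rewrite ?iota_uniq//; last by move=> i; exact: exprn_ge0.
  move=> i si.
  by rewrite mem_iota ltnS; exact: leq_bigmax_seq.
have -> : iota 0 N = index_iota 0 N by rewrite /index_iota subn0.
rewrite big_mkord -[leRHS]mul1r ler_pdivlMr ?subr_gt0// mulrC.
have := subrX1 q N; move/(congr1 -%R); rewrite -mulNr !opprB => <-.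
by rewrite lerBlDr lerDl exprn_ge0.
Qed.

End DoubleSums.

Section EntireSeries.
Context {R : realType}.
Implicit Types (a b : nat -> R[i]) (u v p : R[i]).

(** Infinite radius of convergence, stated as boundedness of the terms because that is what gets
    verified; summability follows in [entire_coef_bound]. *)
Definition entire_coef a : Prop :=
  forall x : R, 0 <= x -> exists M : R, forall n, nc (a n) * x ^+ n <= M.

Definition psum a u : R[i] := csum (fun n : nat => a n * u ^+ n).

Lemma entire_coef_bound a (x : R) : entire_coef a -> 0 <= x ->
  exists M : R, forall s : seq nat, uniq s -> \sum_(n <- s) nc (a n) * x ^+ n <= M.
Proof.
(* If the terms at 2x are at most M, those at x are at most M / 2^n. *)
move=> ea x0; have [|M hM] := ea (2 * x); first by rewrite mulr_ge0.
have M0 : 0 <= M by apply: le_trans (hM 0); rewrite mulr_ge0 ?nc_ge0 ?exprn_ge0 ?mulr_ge0.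
exists (M * (1 - 2^-1)^-1) => s us.
have h2 : 0 <= (2^-1 : R) < 1 by rewrite invr_ge0 ler0n invf_lt1 ?ltr1n ?ltr0n.
apply: le_trans (ler_wpM2l M0 (geometric_sum_le h2 us)); rewrite mulr_sumr.
apply: ler_sum => n _; apply: le_trans (ler_wpM2r _ (hM n)).
  rewrite exprMn -!mulrA [_ * 2^-1 ^+ n]mulrC [2 ^+ n * _]mulrA -exprMn mulfV//.
  by rewrite expr1n mul1r.
by rewrite exprn_ge0// invr_ge0.
Qed.

Lemma entire_coef_bsum a (x : R) : entire_coef a -> 0 <= x ->
  exists M : R, forall u, nc u <= x -> bsum (fun n => a n * u ^+ n) M.
Proof.
move=> ea x0; have [M hM] := entire_coef_bound ea x0; exists M => u ux s us.
apply: le_trans (hM s us); apply: ler_sum => n _.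
by rewrite ncM ncX ler_wpM2l ?nc_ge0// lerXn2r ?nnegrE ?nc_ge0.
Qed.

Lemma entire_coef_asum a u : entire_coef a -> asum (fun n => a n * u ^+ n).
Proof.
by move=> ea; have [M hM] := entire_coef_bsum ea (nc_ge0 u); exists M; exact: hM.
Qed.

(** The Taylor coefficients at [p]. For k < j the truncated exponent [k - j] is harmless, since the
    binomial coefficient is 0. *)
Definition recenter p a : nat -> R[i] :=
  fun j => csum (fun k : nat => a k * ('C(k, j)%:R * p ^+ (k - j))).

(** For fixed k the absolute values sum over j to |a_k| (|p| + |v|)^k by the binomial theorem, and
    these are summable over k. *)
Lemma recenter_asum a p v : entire_coef a -> asum (fun jk : nat * nat =>
  a jk.2 * ('C(jk.2, jk.1)%:R * p ^+ (jk.2 - jk.1)) * v ^+ jk.1).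
Proof.
move=> ea; have x0 : 0 <= nc p + nc v by rewrite addr_ge0 ?nc_ge0.
have [M hM] := entire_coef_bound ea x0; exists M.
pose h (kj : nat * nat) :=
  a kj.1 * ('C(kj.1, kj.2)%:R * p ^+ (kj.1 - kj.2)) * v ^+ kj.2.
apply: (@bsum_inj _ _ _ (fun jk : nat * nat => (jk.2, jk.1)) h).
  by move=> [x y] [x' y'] [-> ->].
apply: (bsum_pair _ hM) => k s us.
rewrite exprDn; under eq_bigr => j _ do rewrite /h/= !ncM nc_nat !ncX -!mulrA.
rewrite -mulr_sumr ler_wpM2l ?nc_ge0// -(big_mkord predT (fun j =>
  nc p ^+ (k - j) * nc v ^+ j *+ 'C(k, j))) /=.
rewrite (bigID (fun j => (j < k.+1)%N)) /= [X in _ + X]big1 ?addr0; last first.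
  by move=> j; rewrite -leqNgt => kj; rewrite bin_small// mul0r.
rewrite -big_filter; under eq_bigr => j _ do rewrite mulr_natl.
apply: ler_sum_sub; rewrite ?filter_uniq ?iota_uniq//.
  by move=> j; rewrite mem_filter mem_index_iota => /andP[].
by move=> j; rewrite mulrn_wge0// mulr_ge0 ?exprn_ge0 ?nc_ge0.
Qed.

Lemma recenter_psum a p v : entire_coef a -> psum a (p + v) = psum (recenter p a) v.
Proof.
move=> ea; have ha := recenter_asum p v ea.
have := @csum_fubini R _ _ (fun j k : nat =>
  a k * ('C(k, j)%:R * p ^+ (k - j)) * v ^+ j) ha.
rewrite /psum => e.
transitivity (csum (fun k : nat => csum (fun j : nat =>
  a k * ('C(k, j)%:R * p ^+ (k - j)) * v ^+ j))); last first.
  rewrite -e; congr csum; apply/funext => j.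
  rewrite /recenter mulrC -csumZ; first by congr csum; apply/funext => k; rewrite mulrC.
  (* At v = 1 the double family contains the j-th row unweighted, which gives the summability of
     that row. *)
  have [M hM] := recenter_asum p 1 ea; exists M.
  have := @bsum_inj _ _ _ (fun k : nat => (j, k)) _ _ _ hM.
  rewrite /= expr1n; under [X in bsum X]eq_fun do rewrite mulr1.
  by apply=> x y [].
congr csum; apply/funext => k; apply/esym/has_sum_unique.
set g := fun j : nat => _.
have -> : a k * (p + v) ^+ k = \sum_(j <- iota 0 k.+1) g j.
  have -> : iota 0 k.+1 = index_iota 0 k.+1 by rewrite /index_iota subn0.
  rewrite exprDn big_mkord mulr_sumr; apply: eq_bigr => j _; rewrite /g.
  by rewrite -[_ *+ 'C(k, j)]mulr_natl; ring.
apply: has_sum_fin; rewrite ?iota_uniq// => j.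
by rewrite mem_iota add0n -leqNgt /g => kj; rewrite bin_small// mul0r mulr0 mul0r.
Qed.

Lemma recenter_entire a p : entire_coef a -> entire_coef (recenter p a).
Proof.
move=> ea x x0; have [M hM] := recenter_asum p x%:C ea; exists M => j.
have -> : nc (recenter p a j) * x ^+ j = nc (recenter p a j * x%:C ^+ j).
  by rewrite ncM ncX nc_real ger0_norm.
rewrite /recenter mulrC -csumZ.
  apply: csum_le; have := @bsum_inj _ _ _ (fun k : nat => (j, k)) _ _ _ hM.
  rewrite /=; under [X in bsum X]eq_fun do rewrite mulrC.
  by apply=> ? ? [].
have [N hN] := recenter_asum p 1 ea; exists N.
have := @bsum_inj _ _ _ (fun k : nat => (j, k)) _ _ _ hN.
rewrite /= expr1n; under [X in bsum X]eq_fun do rewrite mulr1.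
by apply=> ? ? [].
Qed.

Lemma entire_coefS a : entire_coef a -> entire_coef (fun n => a n.+1).
Proof.
move=> ea x x0; have [|M hM] := ea (Num.max x 1); first by rewrite le_max x0.
exists M => n; apply: le_trans (hM n.+1); rewrite ler_wpM2l ?nc_ge0//.
have y1 : 1 <= Num.max x 1 by rewrite le_max lexx orbT.
apply: (@le_trans _ _ (Num.max x 1 ^+ n)).
  by rewrite lerXn2r ?nnegrE ?le_max ?lexx ?x0.
by rewrite ler_weXn2l.
Qed.

Lemma psumS a u : entire_coef a -> psum a u = a 0%N + u * psum (fun n => a n.+1) u.
Proof.
move=> ea; apply: has_sum_unique.
have hs := asum_has_sum (entire_coef_asum u (entire_coefS ea)).
have h0 : has_sum (fun n : nat => (n == 0)%:R * a 0%N) (a 0%N).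
  have := @has_sum_singleton R _ (fun n : nat => (n == 0)%:R * a 0%N) 0%N.
  by rewrite mul1r; apply=> j /negPf ->; rewrite mul0r.
have h1 : has_sum (fun n : nat => if n is m.+1 then a m.+1 * u ^+ m.+1 else 0)
    (u * psum (fun n => a n.+1) u).
  apply/has_sumP => e e0.
  have [A0 hA0] := (has_sumP _ _).1 (has_sumZ u hs) _ e0.
  exists (S @` A0)%fset => A A0A.
  (* The index 0 contributes nothing, and the remaining indices of A are the successors of a finite
     set, over which the unshifted series is summed. *)
  have -> : \sum_(i <- A) (if i is m.+1 then a m.+1 * u ^+ m.+1 else 0) =
     \sum_(i <- [fset m in map predn A | m.+1 \in A]%fset) u * (a i.+1 * u ^+ i).
    transitivity (\sum_(i <- [fset x in A | x != 0%N]%fset)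
        (if i is m.+1 then a m.+1 * u ^+ m.+1 else 0)).
      apply/esym/big_fset_incl; first by apply/fsubsetP => x; rewrite !inE => /andP[].
      by move=> [|x] //; rewrite !inE /= => ->.
    transitivity (\sum_(i <- (S @` [fset m in map predn A | m.+1 \in A])%fset)
        (if i is m.+1 then a m.+1 * u ^+ m.+1 else 0)).
      apply: eq_fbigl => -[|m]; rewrite !inE /= ?andbF ?andbT.
        by apply/esym/negbTE/imfsetP => -[].
      apply/idP/imfsetP => [mA|[x /=]]; last by rewrite !inE => /andP[_ h] [->].
      by exists m => //; rewrite !inE /= mA andbT; apply/mapP; exists m.+1.
    rewrite big_imfset /=; last by move=> x y _ _ [].
    by apply: eq_bigr => m _; rewrite exprS; ring.
  apply: hA0; apply/fsubsetP => m mA0; rewrite !inE /=.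
  have mA : m.+1 \in A by apply: (fsubsetP A0A); apply/imfsetP; exists m.
  by rewrite mA andbT; apply/mapP; exists m.+1.
apply: eq_has_sum (has_sumD h0 h1) => -[|n] /=.
  by rewrite mul1r addr0 expr0 mulr1.
by rewrite mul0r add0r.
Qed.

Lemma psum0 a : psum a 0 = a 0%N.
Proof.
apply: has_sum_unique.
have := @has_sum_singleton R _ (fun n : nat => a n * 0 ^+ n) 0%N.
rewrite expr0 mulr1; apply=> -[|j] // _.
by rewrite expr0n mulr0.
Qed.

Lemma psum_shift a n u : entire_coef a -> (forall j, (j < n)%N -> a j = 0) ->
  psum a u = u ^+ n * psum (fun j => a (n + j)%N) u.
Proof.
elim: n a => [|n IH] a ea h; first by rewrite expr0 mul1r.
rewrite psumS// h// add0r IH; [|exact: entire_coefS|by move=> j jn; exact: h].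
by rewrite exprS mulrA.
Qed.

Lemma entire_coef_shift a n : entire_coef a -> entire_coef (fun j => a (n + j)%N).
Proof.
elim: n a => // n IH a ea; exact: (IH _ (entire_coefS ea)).
Qed.

Lemma psum_eq0 a u : (forall n, a n = 0) -> psum a u = 0.
Proof.
move=> h; apply: has_sum_unique.
have := @has_sum_singleton R _ (fun n : nat => a n * u ^+ n) 0%N.
by rewrite h mul0r; apply=> j _; rewrite h mul0r.
Qed.

Lemma near_nc p (d : R) : 0 < d -> \forall z \near (p : (R[i])^o), nc (z - p) < d.
Proof.
move=> d0; have [+ _] := @cvgcP R _ (nbhs (p : (R[i])^o)) _ id p.
by move=> /(_ (@cvg_id _ _)) /(_ d d0).
Qed.

Lemma psum_cvgc0 a : entire_coef a -> forall e : R, 0 < e ->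
  exists2 d : R, 0 < d & forall u, nc u < d -> nc (psum a u - a 0%N) < e.
Proof.
move=> ea e e0; have [M hM] := entire_coef_bsum (entire_coefS ea) ler01.
have M0 : 0 <= M by apply: (@bsum_ge0 _ _ _ _ (hM 0 _)); rewrite nc0.
exists (Num.min 1 (e / (M + 1))).
  by rewrite lt_min ltr01 divr_gt0// ltr_wpDl.
move=> u; rewrite lt_min => /andP[u1 u2].
rewrite psumS// addrC addKr ncM.
have h : nc (psum (fun n => a n.+1) u) <= M by apply/csum_le/hM/ltW.
apply: (@le_lt_trans _ _ (nc u * M)); first by rewrite ler_wpM2l ?nc_ge0.
apply: (@le_lt_trans _ _ (nc u * (M + 1))).
  by rewrite ler_wpM2l ?nc_ge0// lerDl.
by rewrite -ltr_pdivlMr// ltr_wpDl.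
Qed.

(** After re-expansion at the point, the difference quotient in h is itself the power series with
    coefficients b_(n+1), which tends to b_1 as h tends to 0. *)
Lemma psum_holomorphic a p z : entire_coef a ->
  holomorphic_at (fun u => psum a (u - p)) z.
Proof.
move=> ea; pose b := recenter (z - p) a.
have eb : entire_coef b by exact: recenter_entire.
apply/cvg_ex; exists (b 1%N); apply/cvgcP => e e0.
have [d d0 hd] := psum_cvgc0 (entire_coefS eb) e0.
have := near_nc 0 d0; rewrite /dnbhs /within /=; apply: filterS => h.
rewrite subr0 => hh h0; rewrite /= scaler1.
have -> : h + z - p = (z - p) + h by ring.
rewrite recenter_psum// -/b psumS//.
have -> : psum a (z - p) = b 0%N.
  by rewrite -[z - p]addr0 recenter_psum// psum0.
rewrite [X in X - b 0%N]addrC addrK /GRing.scale /= mulKf//.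
exact: hd.
Qed.

Lemma psum_inv_meromorphic a : entire_coef a -> a 0%N != 0 ->
  meromorphic (fun u => (psum a u)^-1).
Proof.
move=> ea a0 p; pose b := recenter p a.
have eb : entire_coef b by exact: recenter_entire.
have bE z : psum a z = psum b (z - p) by rewrite -recenter_psum// addrC subrK.
(* If all coefficients at [p] vanished, the function would vanish everywhere, in particular at 0,
   where it equals [a 0]. *)
have [n bn] : exists n, b n != 0.
  apply: contrapT => h; move: a0; rewrite -psum0 bE psum_eq0 ?eqxx// => n.
  by apply/eqP/negPn/negP => bn; apply: h; exists n.
have exb : exists n, b n != 0 by exists n.
(* The order m of the zero at [p] becomes the order of the pole. *)
case: (ex_minnP exb) => {bn}m bm mmin.
pose c := fun j => b (m + j)%N; have ec : entire_coef c by exact: entire_coef_shift.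
have c0 : c 0%N != 0 by rewrite /c addn0.
exists m, (fun z => (psum c (z - p))^-1); split.
  have cp : 0 < nc (c 0%N) by rewrite lt_neqAle eq_sym nc_eq0 c0 nc_ge0.
  have [d d0 hd] := psum_cvgc0 ec cp.
  have := near_nc p d0; apply: filterS => z /hd hz.
  have gz : psum c (z - p) != 0.
    by apply/eqP => g0; move: hz; rewrite g0 add0r ncN ltxx.
  apply: (@derivableV _ (R[i])^o _ z 1 gz); exact: psum_holomorphic.
(* The factorisation inverts to an equality at every z, including z = p: [invfM] holds with the
   convention 0^-1 = 0. *)
apply: nearW => z.
rewrite bE (psum_shift _ eb (n := m)); last first.
  move=> j jm; apply/eqP/negPn/negP => bj; have := mmin _ bj.
  by rewrite leqNgt jm.
by rewrite invfM mulrC.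
Qed.

End EntireSeries.

(** * The Newton recursion for Fredholm's series *)

Section FredholmRecursion.
Context {K : comNzRingType} {F : finType}.
Variable w : F -> F -> K.

(** Tuples are finite functions here, so that insertion at a variable position is expressed by
    [lift] and [unlift], as is the deletion of rows and columns in a cofactor. *)
Definition insert_at {n} (j : 'I_n.+1) (g : F) (r : {ffun 'I_n -> F}) :
    {ffun 'I_n.+1 -> F} :=
  [ffun i => oapp r g (unlift j i)].

Lemma insert_at_id n (j : 'I_n.+1) g (r : {ffun 'I_n -> F}) : insert_at j g r j = g.
Proof. by rewrite ffunE unlift_none. Qed.

Lemma insert_at_lift n (j : 'I_n.+1) g (r : {ffun 'I_n -> F}) i :
  insert_at j g r (lift j i) = r i.
Proof. by rewrite ffunE liftK. Qed.

Lemma sum_insert_at n (j : 'I_n.+1) (G : {ffun 'I_n.+1 -> F} -> K) :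
  \sum_s G s = \sum_g \sum_r G (insert_at j g r).
Proof.
rewrite pair_big /=.
rewrite (reindex (fun p : F * {ffun 'I_n -> F} => insert_at j p.1 p.2))//=.
exists (fun s => (s j, [ffun i => s (lift j i)])) => [[g r] _|s _] /=.
  rewrite insert_at_id; congr (_, _); apply/ffunP => i; by rewrite ffunE insert_at_lift.
apply/ffunP => i; rewrite ffunE; case: unliftP => [k ->|->] //=.
by rewrite ffunE.
Qed.

(** [F] may be empty, so the values are obtained by eliminating the argument. *)
Let ffun00 : {ffun 'I_0 -> F} :=
  [ffun i : 'I_0 => match i with Ordinal m h => False_rect _ (notF h) end].

Definition minor_mx {n} (s r : {ffun 'I_n -> F}) : 'M[K]_n :=
  \matrix_(i, j) w (s i) (r j).

Definition minor_sum n : K := \sum_(s : {ffun 'I_n -> F}) \det (minor_mx s s).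

(** Up to sign and a factorial, a coefficient of Fredholm's first minor, the numerator of the
    resolvent kernel. *)
Definition bordered_sum n e f : K :=
  \sum_(s : {ffun 'I_n -> F}) \det (minor_mx (insert_at ord0 e s) (insert_at ord0 f s)).

Fixpoint wpow n e f : K :=
  if n is m.+1 then \sum_g w e g * wpow m g f else (e == f)%:R.

Arguments wpow : simpl never.

Lemma wpowS n e f : wpow n.+1 e f = \sum_g w e g * wpow n g f.
Proof. by []. Qed.

Lemma wpow1 e f : wpow 1 e f = w e f.
Proof.
rewrite wpowS (bigD1 f)//= /wpow eqxx mulr1 big1 ?addr0// => g /negPf ->.
by rewrite mulr0.
Qed.

Lemma minor_sum0 : minor_sum 0 = 1.
Proof.
rewrite /minor_sum (bigD1 ffun00)//=.
rewrite det_mx00 big1 ?addr0// => s /eqP[].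
by apply/ffunP => -[].
Qed.

Lemma minor_sumS n : minor_sum n.+1 = \sum_e bordered_sum n e e.
Proof. by rewrite /minor_sum (@sum_insert_at _ ord0). Qed.

Lemma bordered_sum0 e f : bordered_sum 0 e f = w e f.
Proof.
rewrite /bordered_sum (bigD1 ffun00)//=.
rewrite det_mx11 mxE !insert_at_id big1 ?addr0// => s /eqP[].
by apply/ffunP => -[].
Qed.

Lemma det_insert_at_row n (j : 'I_n.+1) g (r : {ffun 'I_n -> F}) c :
  \det (minor_mx (insert_at j g r) c) =
  (-1) ^+ j * \det (minor_mx (insert_at ord0 g r) c).
Proof.
have -> : minor_mx (insert_at j g r) c =
    row_perm (lift_perm j ord0 1%g) (minor_mx (insert_at ord0 g r) c).
  apply/matrixP => i k; rewrite !mxE; congr (w _ _).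
  case: (unliftP j i) => [l ->|->].
    by rewrite lift_perm_lift perm1 !insert_at_lift.
  by rewrite lift_perm_id !insert_at_id.
rewrite row_permE det_mulmx det_perm odd_lift_perm odd_perm1 addbF addbF.
by rewrite signr_odd.
Qed.

(* In the expansion along the first row, moving row j to the top turns the j-th
   minor into a bordered determinant on the indices other than s_j. *)
Lemma bordered_sumS n e f :
  bordered_sum n.+1 e f =
  w e f * minor_sum n.+1 - n.+1%:R * \sum_g w e g * bordered_sum n g f.
Proof.
rewrite /bordered_sum.
under eq_bigr => s _ do rewrite (expand_det_row _ ord0) big_ord_recl.
rewrite big_split /=; congr (_ + _).
  rewrite /minor_sum mulr_sumr; apply: eq_bigr => s _.
  rewrite mxE !insert_at_id /cofactor addn0 expr0 mul1r; congr (_ * \det _).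
  by apply/matrixP => i j; rewrite !mxE !insert_at_lift.
set X := \sum_g w e g * _.
have -> : n.+1%:R * X = \sum_(j < n.+1) X by rewrite sumr_const card_ord mulr_natl.
rewrite exchange_big /= -sumrN; apply: eq_bigr => j _.
rewrite (@sum_insert_at _ j) -sumrN; apply: eq_bigr => g _.
rewrite -mulrN -sumrN mulr_sumr; apply: eq_bigr => r _.
rewrite mxE insert_at_id insert_at_lift insert_at_id /cofactor add0n; congr (_ * _).
have -> : row' ord0 (col' (lift ord0 j)
    (minor_mx (insert_at ord0 e (insert_at j g r))
      (insert_at ord0 f (insert_at j g r)))) =
    minor_mx (insert_at j g r) (insert_at ord0 f r).
  apply/matrixP => i k; rewrite !mxE insert_at_lift; congr (w _ _).
  case: (unliftP ord0 k) => [l ->|->].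
    have -> : lift (lift ord0 j) (lift ord0 l) = lift ord0 (lift j l).
      by apply: val_inj; rewrite /= /bump /= !add1n ltnS; case: leq.
    by rewrite !insert_at_lift.
  have -> : lift (lift ord0 j) ord0 = ord0 by apply: val_inj.
  by rewrite !insert_at_id.
(* The cofactor sign (-1)^(j+1) and the sign (-1)^j of the row move multiply to -1 for every j; this
   is why the n+1 terms are equal. *)
rewrite (@det_insert_at_row _ j) mulrA -exprD lift0 addSn exprS.
rewrite -signr_odd addnn odd_double.
by rewrite mulr1 mulN1r.
Qed.

(** Unfolding of [bordered_sumS]: each step lengthens the path starting at e by one edge and
    contributes minus the current size, and after j steps these factors amount to (-1)^j times the
    falling factorial. *)
Lemma bordered_sumE n e f :
  bordered_sum n e f =
  \sum_(j < n.+1) (-1) ^+ j * (n ^_ j)%:R * minor_sum (n - j) * wpow j.+1 e f.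
Proof.
elim: n e f => [|n IH] e f.
  by rewrite bordered_sum0 big_ord1 minor_sum0 !mulr1 mul1r wpow1.
rewrite bordered_sumS big_ord_recl expr0 ffactn0 !mul1r subn0 wpow1.
rewrite [w e f * _]mulrC; congr (_ + _).
under eq_bigr => g _ do rewrite IH mulr_sumr.
rewrite exchange_big /= mulr_sumr -sumrN; apply: eq_bigr => j _.
rewrite /bump /= add1n subSS ffactnS /= natrM exprS (wpowS j.+1).
move: (minor_sum _) => t.
rewrite !mulr_sumr -sumrN; apply: eq_bigr => g _.
by ring.
Qed.

(** Closing the border by e = f and summing over e turns bordered determinants into minors of size
    n+1 and matrix powers into traces. *)
Lemma minor_sum_newton n :
  minor_sum n.+1 = \sum_(j < n.+1)
    (-1) ^+ j * (n ^_ j)%:R * minor_sum (n - j) * \sum_e wpow j.+1 e e.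
Proof.
rewrite minor_sumS; under eq_bigr do rewrite bordered_sumE.
rewrite exchange_big; apply: eq_bigr => j _ /=.
by move: (minor_sum _) => t; rewrite mulr_sumr.
Qed.

Fixpoint wpath e (s : seq F) f : K :=
  if s is g :: s' then w e g * wpath g s' f else w e f.

Lemma wpathE e s f : wpath e s f = \prod_(p <- zip (e :: s) (rcons s f)) w p.1 p.2.
Proof. by elim: s e => [|g s IH] e; rewrite /= big_cons ?big_nil ?mulr1 ?IH. Qed.

Lemma sum_tupleS n (G : n.+1.-tuple F -> K) :
  \sum_s G s = \sum_g \sum_(s : n.-tuple F) G (cons_tuple g s).
Proof.
rewrite pair_big /= (reindex (fun p : F * n.-tuple F => cons_tuple p.1 p.2))//=.
exists (fun s => (thead s, behead_tuple s)) => [[g r] _|s _] /=.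
  by congr (_, _); apply: val_inj.
by rewrite [s in RHS]tuple_eta; apply: val_inj.
Qed.

Lemma wpow_paths n e f : wpow n.+1 e f = \sum_(s : n.-tuple F) wpath e s f.
Proof.
elim: n e f => [|n IH] e f.
  rewrite wpow1 (bigD1 [tuple])//= big1 ?addr0// => s.
  by rewrite [s]tuple0.
rewrite wpowS sum_tupleS; apply: eq_bigr => g _; rewrite IH mulr_sumr.
by [].
Qed.

Lemma wpow_trace n : \sum_e wpow n.+1 e e =
  \sum_(s : n.+1.-tuple F) \prod_(p <- zip s (rot 1 s)) w p.1 p.2.
Proof.
rewrite sum_tupleS; apply: eq_bigr => e _; rewrite wpow_paths.
by apply: eq_bigr => s _; rewrite wpathE /= rot1_cons.
Qed.

Lemma minor_sum_tuple n : minor_sum n = \sum_(s : n.-tuple F)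
  \det (\matrix_(i < n, j < n) w (tnth s i) (tnth s j)).
Proof.
rewrite /minor_sum (reindex (fun s : n.-tuple F => [ffun i => tnth s i])) /=.
  apply: eq_bigr => s _; congr (\det _); apply/matrixP => i j.
  by rewrite !mxE !ffunE.
exists (fun s : {ffun 'I_n -> F} => [tuple s i | i < n]) => s _.
  by apply: eq_from_tnth => i; rewrite tnth_mktuple ffunE.
by apply/ffunP => i; rewrite ffunE tnth_mktuple.
Qed.

Theorem fredholm_newton n :
  \sum_(s : n.+1.-tuple F) \det (\matrix_(i < n.+1, j < n.+1) w (tnth s i) (tnth s j)) =
  \sum_(j < n.+1) (-1) ^+ j * (n ^_ j)%:R *
    (\sum_(s : (n - j).-tuple F)
      \det (\matrix_(i < n - j, k < n - j) w (tnth s i) (tnth s k))) *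
    \sum_(s : j.+1.-tuple F) \prod_(p <- zip s (rot 1 s)) w p.1 p.2.
Proof.
rewrite -minor_sum_tuple minor_sum_newton; apply: eq_bigr => j _.
by rewrite minor_sum_tuple wpow_trace.
Qed.

End FredholmRecursion.

(** * Primitive cycles as periodic words *)

Section PeriodicWords.
Context {T : choiceType}.
Variable x0 : T.
Implicit Types (s t : seq T) (f g : nat -> T).

(* A word is studied through its periodic extension: a word and its powers have
   the same extension, and rotations become shifts. *)
Definition per s i : T := nth x0 s (i %% size s).

Definition periodic (U : Type) (f : nat -> U) d : Prop := forall i, f (i + d)%N = f i.

Definition minimal_period f d : Prop :=
  [/\ (0 < d)%N, periodic f d & forall d', (0 < d')%N -> periodic f d' -> (d <= d')%N].

(** For a nonempty word, this amounts to not being a proper power of a shorter word. *)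
Definition primitive_word s : Prop := minimal_period (per s) (size s).

Lemma per_small s i : (i < size s)%N -> per s i = nth x0 s i.
Proof. by move=> h; rewrite /per modn_small. Qed.

Lemma per_periodic s : periodic (per s) (size s).
Proof. by move=> i; rewrite /per modnDr. Qed.

Lemma periodicM (U : Type) (f : nat -> U) d k : periodic f d -> periodic f (k * d).
Proof.
move=> h; elim: k => [|k IH] i; first by rewrite mul0n addn0.
by rewrite mulSn [(d + _)%N]addnC addnA h IH.
Qed.

Lemma periodic_dvd (U : Type) (f : nat -> U) d k :
  periodic f d -> (d %| k)%N -> periodic f k.
Proof. by move=> h /dvdnP[m ->]; exact: periodicM. Qed.

Lemma periodic_mod (U : Type) (f : nat -> U) d i : periodic f d -> f (i %% d)%N = f i.
Proof. by move=> h; rewrite [in RHS](divn_eq i d) addnC periodicM. Qed.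

Lemma periodic_shift (U : Type) (f : nat -> U) d j :
  periodic f d -> periodic (fun i => f (i + j)%N) d.
Proof. by move=> h i; rewrite addnAC h. Qed.

(** The shift by j is undone by a further shift by [j * n - j], which is its inverse up to a
    multiple of the period n. *)
Lemma periodic_unshift (U : Type) (f : nat -> U) d n j : (0 < n)%N -> periodic f n ->
  periodic (fun i => f (i + j)%N) d -> periodic f d.
Proof.
move=> n0 fn fd i; have jn : (j <= j * n)%N by rewrite leq_pmulr.
rewrite -(periodicM j fn (i + d)%N) -(periodicM j fn i).
have := fd (i + (j * n - j))%N.
have -> : (i + (j * n - j) + d + j)%N = (i + d + j * n)%N.
  by move: jn; lia.
by have -> : (i + (j * n - j) + j)%N = (i + j * n)%N by move: jn; lia.
Qed.

(** The remainder of n modulo d is again a period, so minimality forces it to be 0. *)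
Lemma minimal_period_dvd f d n : minimal_period f d -> periodic f n -> (d %| n)%N.
Proof.
move=> [d0 fd dmin] fn; rewrite /dvdn; case: (posnP (n %% d)) => // r0.
have : periodic f (n %% d).
  move=> i; rewrite -(periodicM (n %/ d) fd) -addnA [(n %% d + _)%N]addnC -divn_eq.
  exact: fn.
by move=> /(dmin _ r0); rewrite leqNgt ltn_pmod.
Qed.

Lemma minimal_period_exists f n : (0 < n)%N -> periodic f n ->
  exists d, minimal_period f d.
Proof.
move=> n0 fn; pose P d := (0 < d)%N && `[< periodic f d >].
have exP : exists d, P d by exists n; rewrite /P n0; apply/asboolP.
case: (ex_minnP exP) => d /andP[d0 /asboolP fd] dmin; exists d; split=> // d' d'0 fd'.
by apply: dmin; rewrite /P d'0; apply/asboolP.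
Qed.

Lemma per_inj s t : size s = size t -> per s =1 per t -> s = t.
Proof.
move=> st h; apply: (@eq_from_nth _ x0) => // i si.
by rewrite -!per_small ?h// -st.
Qed.

Lemma nth_flatten_nseq s m i : (i < m * size s)%N ->
  nth x0 (flatten (nseq m s)) i = per s i.
Proof.
elim: m i => // m IH i; rewrite mulSn => hi; rewrite /= nth_cat; case: ltnP => si.
  by rewrite per_small.
rewrite IH; last by rewrite ltn_subLR.
by rewrite -(@per_periodic s (i - size s)%N) subnK.
Qed.

Lemma size_flatten_nseq s m : size (flatten (nseq m s)) = (m * size s)%N.
Proof. by rewrite size_flatten /shape map_nseq sumn_nseq mulnC. Qed.

Lemma per_flatten_nseq s m : (0 < m)%N -> (0 < size s)%N ->
  per (flatten (nseq m s)) =1 per s.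
Proof.
move=> m0 s0 i; rewrite {1}/per size_flatten_nseq nth_flatten_nseq.
  by rewrite periodic_mod//; apply: periodicM; exact: per_periodic.
by rewrite ltn_pmod// muln_gt0 m0.
Qed.

Lemma per_rot s j : (0 < size s)%N -> (j <= size s)%N ->
  per (rot j s) =1 fun i => per s (i + j)%N.
Proof.
move=> s0 js i.
rewrite -(periodic_mod i (periodic_shift j (@per_periodic s))).
rewrite /per size_rot; set k := (i %% size s)%N.
have ks : (k < size s)%N by rewrite ltn_pmod.
rewrite /rot nth_cat size_drop; case: ltnP => h.
  by rewrite nth_drop modn_small addnC// -ltn_subRL.
rewrite nth_take; last by lia.
congr nth; have -> : (k + j = (k - (size s - j)) + size s)%N by lia.
by rewrite modnDr modn_small//; lia.
Qed.

(** When k is a period of f, these are the words of length k that run round f, one for each starting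
    point. *)
Definition window k f j : k.-tuple T := [tuple f (i + j)%N | i < k].

Lemma per_window k f j : (0 < k)%N -> periodic f k ->
  per (window k f j) =1 fun i => f (i + j)%N.
Proof.
move=> k0 fk i; rewrite /per size_tuple.
have h : (i %% k < k)%N by rewrite ltn_pmod.
have := nth_mktuple (fun i : 'I_k => f (i + j)%N) x0 (Ordinal h) => /= ->.
exact: periodic_mod (periodic_shift j fk).
Qed.

Lemma window_eq k f g j j' : (0 < k)%N -> periodic f k -> periodic g k ->
  window k f j = window k g j' -> forall i, f (i + j)%N = g (i + j')%N.
Proof.
move=> k0 fk gk e i.
by rewrite -(@per_window k f j k0 fk) -(@per_window k g j' k0 gk) e.
Qed.

(** On the periodic extension the closing edge is no special case: adjacency is one condition at
    every index. *)
Lemma cycleP_per (e : rel T) s : (0 < size s)%N ->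
  reflect (forall i, e (per s i) (per s i.+1)) (path.cycle e s).
Proof.
case: s => // x p _; apply: (iffP (pathP x0)) => h i.
  rewrite -(periodic_mod i (@per_periodic _)) -(periodic_mod i.+1 (@per_periodic _)).
  rewrite -addn1 -modnDml addn1.
  set k := (i %% _)%N; have ks : (k < (size p).+1)%N by rewrite ltn_pmod.
  have := h k; rewrite size_rcons => /(_ ks).
  rewrite nth_rcons -rcons_cons nth_rcons /= ks.
  rewrite /per /= modn_mod (modn_small ks).
  move: ks; rewrite ltnS leq_eqVlt => /orP[/eqP ->|kp].
    by rewrite ltnn eqxx modnn.
  by rewrite kp (modn_small (_ : k.+1 < (size p).+1)%N)// modn_small.
rewrite size_rcons => ip; have := h i.
rewrite per_small//= -rcons_cons !nth_rcons /= ip.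
move: ip; rewrite ltnS leq_eqVlt => /orP[/eqP ->|kp].
  by rewrite ltnn eqxx /per /= modnn.
by rewrite kp per_small.
Qed.

Lemma minimal_period_shift f g j j' l l' :
  minimal_period f l -> minimal_period g l' ->
  (forall i, f (i + j)%N = g (i + j')%N) -> l = l'.
Proof.
move=> [l0 fl lmin] [l'0 gl' l'min] e; apply/eqP; rewrite eqn_leq; apply/andP; split.
  apply: lmin => //; apply: (periodic_unshift l0 fl (j := j)) => i.
  by rewrite !e (periodic_shift j' gl').
apply: l'min => //; apply: (periodic_unshift l'0 gl' (j := j')) => i.
by rewrite -!e (periodic_shift j fl).
Qed.

(** Equal windows at i < j would give f the period j - i, which is less than d. *)
Lemma window_inj k f d : (0 < k)%N -> minimal_period f d -> (d %| k)%N ->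
  {in [pred j | (j < d)%N] &, injective (window k f)}.
Proof.
move=> k0 [d0 fd dmin] dk i j; rewrite !inE => hi hj.
have fk := periodic_dvd fd dk.
wlog ij : i j hi hj / (i <= j)%N => [h|] e.
  by case/orP: (leq_total i j) => /h h'; [exact: h'|exact/esym/h'].
move: ij; rewrite leq_eqVlt => /orP[/eqP //|ij].
have : periodic f (j - i).
  apply: (periodic_unshift d0 fd (j := i)) => x.
  rewrite (window_eq k0 fk fk e x) -addnA; congr f; congr addn; exact: subnK (ltnW ij).
by move=> /dmin; rewrite subn_gt0 => /(_ ij); lia.
Qed.

Lemma rot_of_shift s t j j' : (0 < size s)%N -> size s = size t ->
  (forall i, per s (i + j)%N = per t (i + j')%N) -> exists k, t = rot k s.
Proof.
move=> s0 st e; have j'n : (j' <= j' * size t)%N by rewrite leq_pmulr -?st.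
(* [j' * size t - j'] is a natural number representing -j' modulo the common length. *)
exists ((j' * size t - j' + j) %% size s)%N; apply: per_inj; first by rewrite size_rot.
move=> i; rewrite per_rot//; last by rewrite ltnW// ltn_pmod.
have hs : periodic (fun m => per s (i + m)%N) (size s).
  by move=> m; rewrite addnA per_periodic.
rewrite (periodic_mod _ hs) addnA e -addnA subnK//.
by rewrite (periodicM j' (@per_periodic t)).
Qed.

End PeriodicWords.

Section PeriodicProducts.
Context {R : comNzRingType}.

Lemma prod_periodic_shift (g : nat -> R) l j : periodic g l ->
  \prod_(i < l) g (i + j)%N = \prod_(i < l) g i.
Proof.
move=> gl; elim: j => [|j IH]; first by apply: eq_bigr => i _; rewrite addn0.
rewrite -IH; case: l gl {IH} => [|l] gl; first by rewrite !big_ord0.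
rewrite big_ord_recr big_ord_recl /= mulrC add0n -(gl j) [in RHS]addnC.
by rewrite addSnnS addnC; congr (_ * _); apply: eq_bigr => i _; rewrite addSnnS.
Qed.

Lemma prod_periodic (g : nat -> R) l m j : periodic g l ->
  \prod_(i < m * l) g (i + j)%N = (\prod_(i < l) g i) ^+ m.
Proof.
move=> gl; elim: m => [|m IH]; first by rewrite mul0n big_ord0 expr0.
rewrite mulSn big_split_ord /= exprS prod_periodic_shift//; congr (_ * _).
by rewrite -IH; apply: eq_bigr => i _; rewrite -addnA addnC gl.
Qed.

End PeriodicProducts.

(** * Closed paths of a given length, sorted by their primitive cycle *)

Section PrimitiveCycles.
Context {R : realType} {X : oriented_graph}.
Variables (w : edge X -> edge X -> R) (x0 : edge X).
Hypothesis w_adj : forall e f, w e f != 0 -> target e = source f.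
Local Notation E := (edge X).
Local Notation per := (per x0).

Lemma size_closed_path (p : closed_path X) : (0 < size (val p))%N.
Proof. by case: p => -[]. Qed.

Lemma path_weight_per (s : seq E) :
  path_weight w s = \prod_(i < size s) w (per s i) (per s i.+1).
Proof.
rewrite /path_weight (big_nth (x0, x0)) size_zip size_rot minnn big_mkord.
apply: eq_bigr => i _; rewrite nth_zip ?size_rot//=.
have s0 : (0 < size s)%N by apply: leq_ltn_trans (ltn_ord i).
rewrite -[nth x0 s i]per_small// -[nth x0 (rot 1 s) i]per_small ?size_rot//.
by rewrite per_rot// addn1.
Qed.

Lemma primitive_cycle_rep (c : gcycle X) : primitive_cycle c ->
  primitive_word x0 (val (cycle_rep c)).
Proof.
move=> cp; set q := cycle_rep c; have q0 := size_closed_path q.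
have [d dmin] := minimal_period_exists q0 (per_periodic x0 (val q)).
rewrite /primitive_word; have dq := minimal_period_dvd dmin (per_periodic x0 (val q)).
suff -> : size (val q) = d by [].
have [d0 qd _] := dmin; case/dvdnP: dq => k kE.
have k0 : (0 < k)%N by move: q0; rewrite kE muln_gt0 => /andP[].
have [k1|k2] := leqP k 1.
  have k1' : k = 1%N by lia.
  by rewrite kE k1' mul1n.
(* With a least period d shorter than q, the first d edges form a closed path of which q is the k-th
   power. *)
exfalso; apply: cp; pose r := take d (val q).
have dq : (d <= size (val q))%N by rewrite kE leq_pmull.
have sr : size r = d by rewrite size_takel.
have rq : per r =1 per (val q).
  move=> i; rewrite -(periodic_mod i qd) /per sr nth_take ?ltn_pmod//.
  by rewrite (@modn_small (i %% d))// (leq_trans _ dq)// ltn_pmod.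
have rc : is_closed_path r.
  rewrite /is_closed_path -size_eq0 sr -lt0n d0 /=.
  apply/(cycleP_per x0); rewrite ?sr// => i; rewrite !rq.
  by have /andP[_ hq] := valP q; exact: (elimT (@cycleP_per _ x0 _ _ q0) hq).
exists (cycle_of (Sub r rc)), k; split=> //.
rewrite cycle_pow_of// -[c in LHS]cycle_repK; congr cycle_of; apply: val_inj.
rewrite val_path_pow//=; apply: (@per_inj _ x0).
  by rewrite size_flatten_nseq sr.
by move=> i; rewrite per_flatten_nseq ?sr// rq.
Qed.

(** A rotation of r^k has period |r|, which for k >= 2 is less than its length. *)
Lemma primitive_cycle_of (q : closed_path X) : primitive_word x0 (val q) ->
  primitive_cycle (cycle_of q).
Proof.
move=> [q0 qper qmin] [c1 [k [k2 /eqP]]]; rewrite /cycle_pow.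
have k0 : (0 < k)%N by apply: leq_trans k2.
set r := cycle_rep c1; have r0 := size_closed_path r.
rewrite eq_sym => /cycle_ofP[j]; rewrite val_path_pow// => qE.
have sq : size (val q) = (k * size (val r))%N.
  by rewrite qE size_rot size_flatten_nseq.
wlog jle : j qE / (j <= size (flatten (nseq k (val r))))%N => [h|].
  case: (leqP j (size (flatten (nseq k (val r))))) => jk; first exact: (h j).
  by apply: (h 0%N) => //; rewrite rot0 qE rot_oversize// ltnW.
have : periodic (per (val q)) (size (val r)).
  move=> i; rewrite qE !per_rot ?size_flatten_nseq ?muln_gt0 ?k0// -?size_flatten_nseq//.
  by rewrite !per_flatten_nseq// addnAC per_periodic.
move=> /(qmin _ r0); rewrite sq; move: k2 r0; nia.
Qed.

Definition cycle_word (c : gcycle X) : nat -> E := per (val (cycle_rep c)).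

(** The closed paths of length k that go round c, one per starting edge; their number is the factor
    l(c) in p_k(A). *)
Definition cycle_windows k (c : gcycle X) : seq (k.-tuple E) :=
  if (cycle_length c %| k)%N
  then [seq window k (cycle_word c) j | j <- iota 0 (cycle_length c)] else [::].

(* The closed paths of length k whose primitive root lies in A. *)
Definition windows k (A : {fset primitive_cycles X}) : seq (k.-tuple E) :=
  flatten [seq cycle_windows k (val c) | c <- A].

Lemma cycle_word_minimal (c : primitive_cycles X) :
  minimal_period (cycle_word (val c)) (cycle_length (val c)).
Proof. by apply: primitive_cycle_rep; exact: set_valP c. Qed.

Lemma mem_cycle_windows k (c : gcycle X) s : s \in cycle_windows k c ->
  (cycle_length c %| k)%N /\
  exists2 j, (j < cycle_length c)%N & s = window k (cycle_word c) j.
Proof.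
rewrite /cycle_windows; case: ifP => // ck /mapP[j].
by rewrite mem_iota => /andP[_ jc] ->; split=> //; exists j.
Qed.

Lemma cycle_windows_uniq k (c : primitive_cycles X) : (0 < k)%N ->
  uniq (cycle_windows k (val c)).
Proof.
move=> k0; rewrite /cycle_windows; case: ifP => // ck.
rewrite map_inj_in_uniq ?iota_uniq// => i j; rewrite !mem_iota !add0n => hi hj.
exact: (window_inj x0 k0 (cycle_word_minimal c) ck).
Qed.

(** A common window makes the two periodic words shifts of each other. Their minimal periods then
    agree, and the representatives are rotations of one another. *)
Lemma cycle_windows_disjoint k (c c' : primitive_cycles X) s : (0 < k)%N ->
  s \in cycle_windows k (val c) -> s \in cycle_windows k (val c') -> c = c'.
Proof.
move=> k0 /mem_cycle_windows[ck [j jc sE]] /mem_cycle_windows[c'k [j' jc' sE']].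
have [l0 cl _] := cycle_word_minimal c; have [l'0 c'l _] := cycle_word_minimal c'.
have e := window_eq x0 k0 (periodic_dvd cl ck) (periodic_dvd c'l c'k)
  (etrans (esym sE) sE').
have ll := minimal_period_shift (cycle_word_minimal c) (cycle_word_minimal c') e.
apply: val_inj; rewrite -[val c]cycle_repK -[val c']cycle_repK.
apply/eqP/cycle_ofP.
by have [m mE] := rot_of_shift (size_closed_path _) ll e; exists m.
Qed.

Lemma windows_uniq k A : (0 < k)%N -> uniq (windows k A).
Proof.
move=> k0; rewrite /windows; have := fset_uniq A; move: (enum_fset A) => l.
elim: l => //= c l IH /andP[cl ul]; rewrite cat_uniq cycle_windows_uniq// IH// andbT.
apply/hasPn => s /flattenP[_ /mapP[c' c'l ->] sc']; apply/negP => sc.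
by move: cl; rewrite (cycle_windows_disjoint k0 sc sc') c'l.
Qed.

Lemma cycle_windows_weight k (c : primitive_cycles X) : (0 < k)%N ->
  (cycle_length (val c) %| k)%N ->
  {in cycle_windows k (val c), forall s : k.-tuple E,
    path_weight w s = cycle_weight w (val c) ^+ (k %/ cycle_length (val c))}.
Proof.
move=> k0 ck s /mem_cycle_windows[_ [j jc ->]].
have [l0 cl _] := cycle_word_minimal c; have ck' := periodic_dvd cl ck.
rewrite path_weight_per size_tuple.
pose g i := w (cycle_word (val c) i) (cycle_word (val c) i.+1).
have gl : periodic g (cycle_length (val c)).
  by move=> i; rewrite /g -addSn !cl.
under eq_bigr => i _ do rewrite !per_window//.
rewrite /cycle_weight [in RHS]path_weight_per -/(cycle_length _).
have := prod_periodic (k %/ cycle_length (val c)) j gl; rewrite divnK//.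
Qed.

Definition cycle_power_sum k (A : {fset primitive_cycles X}) : R :=
  \sum_(c <- A | (cycle_length (val c) %| k)%N)
    (cycle_length (val c))%:R * cycle_weight w (val c) ^+ (k %/ cycle_length (val c)).

Lemma cycle_power_sumE k A : (0 < k)%N ->
  cycle_power_sum k A = \sum_(s <- windows k A) path_weight w s.
Proof.
move=> k0; rewrite /cycle_power_sum /windows big_flatten big_map /= [LHS]big_mkcond /=.
apply: eq_bigr => c _; case: ifP => ck; last by rewrite /cycle_windows ck big_nil.
rewrite (eq_big_seq _ (cycle_windows_weight k0 ck)).
rewrite big_const_seq count_predT iter_addr addr0 mulr_natl /cycle_windows ck.
by rewrite size_map size_iota.
Qed.

(** A tuple of nonzero weight is a closed path because of [w_adj]; the cycle sought is that of its
    initial segment of minimal period. *)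
Lemma windows_cover k (s : k.-tuple E) : (0 < k)%N -> path_weight w s != 0 ->
  exists c : primitive_cycles X, forall A : {fset primitive_cycles X},
    c \in A -> s \in windows k A.
Proof.
move=> k0 ws; have s0 : (0 < size s)%N by rewrite size_tuple.
have sadj i : target (per s i) == source (per s i.+1).
  have sP := per_periodic x0 s.
  have h : periodic (fun i => w (per s i) (per s i.+1)) (size s).
    by move=> m; rewrite -addSn !sP.
  apply/eqP/w_adj; rewrite -(periodic_mod i h).
  move: ws; rewrite path_weight_per prodf_seq_neq0 => /allP.
  have im : (i %% size s < size s)%N by rewrite ltn_pmod.
  by move=> /(_ (Ordinal im)); rewrite mem_index_enum => /(_ isT).
have [d dmin] := minimal_period_exists s0 (per_periodic x0 s).
have dk := minimal_period_dvd dmin (per_periodic x0 s); rewrite size_tuple in dk.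
have [d0 sd _] := dmin; have dk' : (d <= k)%N by apply: dvdn_leq.
pose r := take d s; have sr : size r = d by rewrite size_takel// size_tuple.
have rs : per r =1 per s.
  move=> i; rewrite -(periodic_mod i sd) /per sr nth_take ?ltn_pmod//.
  by rewrite size_tuple (@modn_small (i %% d))// (leq_trans _ dk')// ltn_pmod.
have rc : is_closed_path r.
  rewrite /is_closed_path -size_eq0 sr -lt0n d0 /=.
  by apply/(cycleP_per x0); rewrite ?sr// => i; rewrite !rs.
pose q : closed_path X := Sub r rc.
have qp : primitive_cycle (cycle_of q).
  apply: primitive_cycle_of; rewrite /primitive_word /= sr.
  by rewrite (_ : per r = per s)//; exact/funext.
exists (SigSub (mem_set qp)) => A cA; apply/flattenP.
eexists; first by apply/mapP; exists (SigSub (mem_set qp)); [exact: cA|].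
rewrite /= /cycle_windows cycle_length_of /= sr dk; apply/mapP.
set p := cycle_rep (cycle_of q).
have /eqP/cycle_ofP[j qE] := cycle_repK (cycle_of q).
have sp : size (val p) = d by rewrite -sr -[r]/(val q) qE size_rot.
wlog jd : j qE / (j <= d)%N => [h|].
  have [jd|/ltnW jd] := leqP j d; first exact: (h j).
  by apply: (h 0%N) => //; rewrite qE rot0 rot_oversize// sp.
(* The rotation index may equal d, whereas starting points are below d. *)
exists (j %% d)%N; first by rewrite mem_iota ltn_pmod.
apply: eq_from_tnth => i; rewrite tnth_mktuple (tnth_nth x0).
rewrite -[nth x0 s i]per_small ?size_tuple// -rs -[r]/(val q) qE.
rewrite per_rot ?sp// /cycle_word -/p.
have hp : periodic (fun m => per (val p) (i + m)%N) d.
  by move=> m; rewrite addnA -sp per_periodic.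
by rewrite (periodic_mod _ hp).
Qed.

End PrimitiveCycles.

(** * The Newton recursion for Euler products *)

Section NewtonProduct.
Context {K : comNzRingType} {I : eqType}.
Variables (a : I -> K) (l : I -> nat).

Definition power_sum (s : seq I) k : K :=
  \sum_(i <- s | (l i %| k)%N) (l i)%:R * a i ^+ (k %/ l i).

Definition euler_poly (s : seq I) : {poly K} :=
  \prod_(i <- s) (1 - a i *: 'X^(l i)).

Let small N (p : {poly K}) := forall i, (i <= N)%N -> p`_i = 0.

Let smallD N p q : small N p -> small N q -> small N (p + q).
Proof. by move=> hp hq i iN; rewrite coefD hp ?hq ?addr0. Qed.

Let smallM N p q : small N p -> small N (p * q).
Proof.
move=> hp i iN; rewrite coefM big1// => j _.
by rewrite hp ?mul0r// (leq_trans _ iN)// -ltnS.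
Qed.

Let power_poly N s : {poly K} :=
  \poly_(k < N.+1) (if (0 < k)%N then power_sum s k else 0).

(* With L the product and P the generating series of the power sums, this says
   that X L' + P L vanishes modulo X^(N+1). *)
Let small_newton N (s : seq I) : (forall i, i \in s -> (0 < l i)%N) ->
  small N ('X * (euler_poly s)^`() + power_poly N s * euler_poly s).
Proof.
elim: s => [|i s IH] ls.
  rewrite /euler_poly big_nil -polyC1 derivC mulr0 add0r mulr1 => k kN.
  by rewrite coef_poly ltnS kN /power_sum big_nil if_same.
have l0 : (0 < l i)%N by apply: ls; rewrite mem_head.
have {}IH := IH (fun j js => ls j (mem_behead (s := i :: s) js)).
set b := 1 - a i *: 'X^(l i).
set q : {poly K} := \poly_(k < N.+1)
  (if (0 < k)%N && (l i %| k)%N then (l i)%:R * a i ^+ (k %/ l i) else 0).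
have eE : euler_poly (i :: s) = b * euler_poly s by rewrite /euler_poly big_cons.
have pE : power_poly N (i :: s) = q + power_poly N s.
  apply/polyP => k; rewrite coefD !coef_poly; case: ifP => kN; last by rewrite addr0.
  case: ifP => k0; last by rewrite addr0.
  by rewrite /power_sum big_cons /=; case: ifP; rewrite ?add0r.
have bE : 'X * b^`() = - ((l i)%:R * a i *: 'X^(l i)).
  rewrite /b derivB -polyC1 derivC sub0r derivZ derivXn mulrN -scalerAr.
  by case: (l i) l0 => // m _; rewrite mulrnAr -exprS -scaler_nat scalerA mulrC.
(* [q] is a truncation of l a X^l / (1 - a X^l), so multiplying it by [b] leaves l a X^l up to
   degree N. *)
have qb : small N (q * b - (l i)%:R * a i *: 'X^(l i)).
  move=> k kN; rewrite /b mulrBr mulr1 -scalerAr !coefB !coefZ coefMXn coefXn.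
  rewrite !coef_poly !ltnS kN.
  case: (ltngtP k (l i)) => kl.
  - rewrite mulr0 mulr0 !subr0; case: ifP => // /andP[k0 /(dvdn_leq k0)].
    by rewrite leqNgt kl.
  - rewrite (leq_trans (leq_subr _ _) kN) subn_gt0 kl (leq_trans _ kl)//=.
    rewrite mulr0 subr0 dvdn_subl ?(ltnW kl)//.
    case: ifP => // lk; last by rewrite mulr0 subr0.
    have -> : (k %/ l i = ((k - l i) %/ l i).+1)%N.
      by rewrite -[in LHS](subnK (ltnW kl)) divnDr ?dvdnn// divnn l0 addn1.
    by rewrite exprS; ring.
  - by rewrite kl subnn /= l0 dvdnn divnn l0 /= expr1 mulr0 subr0 mulr1 subrr.
rewrite eE pE derivM.
have -> : 'X * (b^`() * euler_poly s + b * (euler_poly s)^`()) +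
    (q + power_poly N s) * (b * euler_poly s) =
  (q * b - (l i)%:R * a i *: 'X^(l i)) * euler_poly s +
  ('X * (euler_poly s)^`() + power_poly N s * euler_poly s) * b.
  rewrite -bE; ring.
by apply: smallD; apply: smallM.
Qed.

Lemma euler_poly_newton (s : seq I) n : (forall i, i \in s -> (0 < l i)%N) ->
  n.+1%:R * (euler_poly s)`_n.+1 =
  - \sum_(j < n.+1) power_sum s j.+1 * (euler_poly s)`_(n - j).
Proof.
move=> ls; apply/eqP; rewrite -addr_eq0; apply/eqP.
have := small_newton (N := n.+1) ls (leqnn _).
rewrite coefD coefXM /= coef_deriv => h; rewrite -[RHS]h mulr_natl; congr (_ + _).
rewrite coefM [RHS]big_ord_recl coef_poly /= mul0r add0r; apply: eq_bigr => j _.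
by rewrite coef_poly /= /bump /= add1n subSS ltnS ltn_ord.
Qed.

Lemma euler_poly0 (s : seq I) : (forall i, i \in s -> (0 < l i)%N) ->
  (euler_poly s)`_0 = 1.
Proof.
move=> ls; rewrite -horner_coef0 /euler_poly horner_prod big_seq big1// => i /ls l0.
by rewrite !hornerE expr0n gtn_eqF// mulr0 subr0.
Qed.

End NewtonProduct.

(** * Bounds and limits obtained from Newton's recursion *)

Section NewtonLimits.
Context {R : realType}.

(** The right-hand side has n+1 terms, each at most W^(n+1) by induction, and this count cancels the
    factor n+1 on the left. *)
Lemma newton_bound (c p : nat -> R[i]) (W : R) : c 0%N = 1 -> 0 <= W ->
  (forall k, nc (p k.+1) <= W ^+ k.+1) ->
  (forall n, n.+1%:R * c n.+1 = - \sum_(j < n.+1) p j.+1 * c (n - j)%N) ->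
  forall n, nc (c n) <= W ^+ n.
Proof.
move=> c0 W0 pW cn n; elim/ltn_ind: n => -[|n] IH; first by rewrite c0 nc1 expr0.
have n0 : 0 < n.+1%:R :> R by rewrite ltr0n.
rewrite -(ler_pM2l n0) -{1}(@nc_nat R) -ncM cn ncN.
apply: le_trans (nc_sum _ _ _) _.
apply: (@le_trans _ _ (\sum_(j < n.+1) W ^+ n.+1)); last first.
  by rewrite sumr_const card_ord mulr_natl.
apply: ler_sum => j _; rewrite ncM.
have -> : W ^+ n.+1 = W ^+ j.+1 * W ^+ (n - j).
  by rewrite -exprD addSn subnKC// -ltnS.
apply: ler_pM; rewrite ?nc_ge0//.
by apply: IH; rewrite ltnS leq_subr.
Qed.

Lemma newton_cvg (T : Type) (F : set_system T) {FF : Filter F}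
    (c p : T -> nat -> R[i]) (d q : nat -> R[i]) :
  (forall x, c x 0%N = 1) -> d 0%N = 1 ->
  (forall k, cvgc F (fun x => p x k.+1) (q k.+1)) ->
  (forall x n, n.+1%:R * c x n.+1 = - \sum_(j < n.+1) p x j.+1 * c x (n - j)%N) ->
  (forall n, n.+1%:R * d n.+1 = - \sum_(j < n.+1) q j.+1 * d (n - j)%N) ->
  forall n, cvgc F (fun x => c x n) (d n).
Proof.
move=> c0 d0 pq cn dn n; elim/ltn_ind: n => -[|n] IH.
  by rewrite d0; apply: eq_cvgc (cvgc_cst 1) => x; rewrite c0.
have n0 : n.+1%:R != 0 :> R[i] by rewrite pnatr_eq0.
rewrite -[d n.+1](mulKf n0) dn.
suff h : cvgc F (fun x => n.+1%:R^-1 * - \sum_(j < n.+1) p x j.+1 * c x (n - j)%N)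
    (n.+1%:R^-1 * - \sum_(j < n.+1) q j.+1 * d (n - j)%N).
  by apply: eq_cvgc h => x; rewrite -cn mulKf.
apply: cvgcZ; apply: cvgcN; apply: cvgc_sum => j _; apply: cvgcM; first exact: pq.
by apply: IH; rewrite ltnS leq_subr.
Qed.

Lemma geometric_tail (C q e : R) : 0 <= q < 1 -> 0 < e -> exists N, C * q ^+ N < e.
Proof.
move=> /andP[q0 q1] e0; have [C0|C0] := lerP C 0.
  by exists 0%N; apply: le_lt_trans e0; rewrite expr0 mulr1.
have : (q ^+ n @[n --> \oo] --> 0)%classic by apply: cvg_expr; rewrite ger0_norm.
move=> /cvgrPdist_lt /(_ (e / C)); rewrite divr_gt0// => /(_ isT)[N _ /(_ N (leqnn N))].
rewrite sub0r normrN ger0_norm ?exprn_ge0// => h; exists N.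
by rewrite mulrC -ltr_pdivlMr.
Qed.

(** Dominated convergence for series: the majorant (W |u|)^n makes the tails small uniformly in x,
    and the finitely many remaining terms converge. *)
Lemma tannery (T : Type) (F : set_system T) {FF : Filter F}
    (c : T -> nat -> R[i]) (d : nat -> R[i]) (W : R) (u : R[i]) :
  (forall x n, nc (c x n) <= W ^+ n) -> (forall n, nc (d n) <= W ^+ n) ->
  0 <= W -> W * nc u < 1 ->
  (forall n, cvgc F (fun x => c x n) (d n)) ->
  cvgc F (fun x => psum (c x) u) (psum d u).
Proof.
move=> cW dW W0 Wu cd e e0; set q := W * nc u in Wu.
have q0 : 0 <= q by rewrite mulr_ge0 ?nc_ge0.
have q01 : 0 <= q < 1 by rewrite q0.
have qn (b : nat -> R[i]) n : nc (b n) <= W ^+ n -> nc (b n * u ^+ n) <= q ^+ n.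
  by move=> h; rewrite ncM ncX exprMn ler_wpM2r ?exprn_ge0 ?nc_ge0.
have ab (b : nat -> R[i]) : (forall n, nc (b n) <= W ^+ n) ->
    asum (fun n => b n * u ^+ n).
  move=> h; exists (1 - q)^-1 => s us; apply: le_trans (geometric_sum_le q01 us).
  by apply: ler_sum => n _; exact: qn.
have e2 : 0 < e / 2 by rewrite divr_gt0.
(* The tail from N on is at most 2 q^N / (1 - q), with 2 because both coefficients are bounded by
   W^n. *)
have [N hN] := geometric_tail (2 * (1 - q)^-1) q01 e2.
have cvN : cvgc F (fun x => \sum_(n < N) (c x n - d n) * u ^+ n)
    (\sum_(n < N) (d n - d n) * u ^+ n).
  apply: cvgc_sum => n _; apply: cvgcM; last exact: cvgc_cst.
  by apply: cvgcD; [exact: cd|apply: cvgcN; exact: cvgc_cst].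
have := cvN _ e2; apply: filterS => x; rewrite [X in _ - X]big1 ?subr0 => [hx|n _].
  2: by rewrite subrr mul0r.
have -> : psum (c x) u - psum d u = csum (fun n : nat => (c x n - d n) * u ^+ n).
  apply/esym/has_sum_unique.
  apply: eq_has_sum (has_sumB (asum_has_sum (ab _ (cW x))) (asum_has_sum (ab _ dW))) => n.
  by rewrite mulrBl.
set f := fun n : nat => _.
have fb n : nc (f n) <= 2 * q ^+ n.
  rewrite /f mulrBl; apply: le_trans (ncB _ _) _.
  by rewrite mulr_natl mulr2n; apply: lerD; exact: qn.
pose f1 n := if (n < N)%N then f n else 0.
pose f2 n := if (n < N)%N then 0 else f n.
have h1 : has_sum f1 (\sum_(n <- iota 0 N) f1 n).
  apply: has_sum_fin; rewrite ?iota_uniq// => n.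
  by rewrite mem_iota add0n leq0n /= /f1 => /negPf ->.
have b2 : bsum f2 (2 * (1 - q)^-1 * q ^+ N).
  move=> s us; rewrite (bigID (fun n => (n < N)%N)) /= big1 ?add0r; last first.
    by move=> n nN; rewrite /f2 nN nc0.
  rewrite -big_filter.
  have -> : [seq n <- s | ~~ (n < N)%N] =
      map (addn N) (map (fun n => n - N)%N [seq n <- s | ~~ (n < N)%N]).
    rewrite -map_comp -[LHS]map_id; apply/eq_in_map => n.
    by rewrite mem_filter -leqNgt => /andP[nN _] /=; rewrite subnKC.
  rewrite big_map; set r := map _ _.
  have ur : uniq r.
    rewrite map_inj_in_uniq ?filter_uniq// => n m; rewrite !mem_filter -!leqNgt.
    by move=> /andP[nN _] /andP[mN _] nm; rewrite -(subnKC nN) nm subnKC.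
  apply: (@le_trans _ _ (\sum_(n <- r) 2 * q ^+ N * q ^+ n)).
    apply: ler_sum => n _; rewrite /f2 ltnNge leq_addr /= -mulrA -exprD; exact: fb.
  rewrite -mulr_sumr [leRHS]mulrAC; apply: ler_wpM2l.
    by rewrite mulr_ge0 ?exprn_ge0.
  exact: geometric_sum_le.
have a2 : asum f2 by exists (2 * (1 - q)^-1 * q ^+ N).
have -> : csum f = \sum_(n <- iota 0 N) f1 n + csum f2.
  apply: has_sum_unique; apply: eq_has_sum (has_sumD h1 (asum_has_sum a2)) => n.
  by rewrite /f1 /f2; case: ifP; rewrite ?addr0 ?add0r.
apply: le_lt_trans (ncD _ _) _; rewrite [e]splitr; apply: ltrD; last first.
  exact: le_lt_trans (csum_le b2) hN.
suff -> : \sum_(n <- iota 0 N) f1 n = \sum_(n < N) (c x n - d n) * u ^+ n by [].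
have -> : iota 0 N = index_iota 0 N by rewrite /index_iota subn0.
by rewrite big_mkord; apply: eq_bigr => n _; rewrite /f1 ltn_ord.
Qed.

Lemma psum_poly (p : {poly R[i]}) u : psum (fun n => p`_n) u = p.[u].
Proof.
rewrite horner_coef; apply: has_sum_unique.
rewrite -(big_mkord predT (fun n => p`_n * u ^+ n)) /index_iota subn0.
apply: has_sum_fin; rewrite ?iota_uniq// => n.
by rewrite mem_iota -leqNgt => h; rewrite nth_default// mul0r.
Qed.

End NewtonLimits.

(** * The Fredholm coefficients *)

Section TupleSums.
Context {R : realType} {E : choiceType}.

Definition incl k (A : {fset E}) (s : k.-tuple A) : k.-tuple E := map_tuple val s.

Definition tuples_in k (A : {fset E}) : seq (k.-tuple E) :=
  [seq @incl k A s | s <- enum {: k.-tuple A}].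

Lemma incl_inj k (A : {fset E}) : injective (@incl k A).
Proof.
move=> s t /(congr1 val) /= h; apply: val_inj => /=.
exact: (inj_map val_inj) h.
Qed.

Lemma tuples_in_uniq k A : uniq (tuples_in k A).
Proof. by rewrite map_inj_uniq ?enum_uniq//; exact: incl_inj. Qed.

Lemma sum_tuples_in k (A : {fset E}) (V : nmodType) (g : k.-tuple E -> V) :
  \sum_(s <- tuples_in k A) g s = \sum_(s : k.-tuple A) g (incl s).
Proof. by rewrite big_map big_enum. Qed.

Lemma mem_tuples_in k (A : {fset E}) (s : k.-tuple E) :
  {subset s <= A} -> s \in tuples_in k A.
Proof.
move=> sA; apply/mapP.
have h i : tnth s i \in A by apply: sA; exact: mem_tnth.
exists [tuple [` h i]%fset | i < k]; first by rewrite mem_enum.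
by apply: eq_from_tnth => i; rewrite tnth_map tnth_mktuple.
Qed.

Definition entries k (l : seq (k.-tuple E)) : {fset E} :=
  [fset x in flatten [seq val s | s <- l]]%fset.

Lemma entriesP k (l : seq (k.-tuple E)) (s : k.-tuple E) :
  s \in l -> {subset s <= entries l}.
Proof.
by move=> sl x xs; rewrite !inE; apply/flattenP; exists (val s); rewrite ?map_f.
Qed.

Lemma bsum_tuples k (g : k.-tuple E -> R[i]) (M : R) :
  (forall A : {fset E}, \sum_(s : k.-tuple A) nc (g (incl s)) <= M) -> bsum g M.
Proof.
move=> h l ul; apply: le_trans (h (entries l)).
rewrite -(sum_tuples_in _ (fun s => nc (g s))).
apply: ler_sum_sub => //; first exact: tuples_in_uniq.
  by move=> s sl; apply: mem_tuples_in; exact: entriesP.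
by move=> s; exact: nc_ge0.
Qed.

(** The sets of all k-tuples over a finite alphabet are cofinal among the finite sets of k-tuples,
    so the unordered sum can be computed along alphabets. *)
Lemma has_sum_tuples k (g : k.-tuple E -> R[i]) t : has_sum g t ->
  cvgc totally (fun A : {fset E} => \sum_(s : k.-tuple A) g (incl s)) t.
Proof.
move=> /has_sumP h e /h[G0 hG0]; exists (entries G0) => // A /= GA.
rewrite -sum_tuples_in.
have -> : \sum_(s <- tuples_in k A) g s = \sum_(s <- [fset x in tuples_in k A]%fset) g s.
  apply: perm_big; apply: uniq_perm; rewrite ?fset_uniq ?tuples_in_uniq// => p.
  by rewrite !inE.
apply: hG0; apply/fsubsetP => s sG; rewrite !inE; apply: mem_tuples_in => x xs.
by apply: (fsubsetP GA); exact: entriesP sG _ xs.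
Qed.

End TupleSums.

Section FiniteBounds.
Context {R : realType} {F : finType}.
Variable w : F -> F -> R.
Hypothesis w0 : forall e f, 0 <= w e f.
Let r e := \sum_f w e f.

Let r_ge0 e : 0 <= r e. Proof. exact: sumr_ge0. Qed.

Let w_le_r e f : w e f <= r e.
Proof. by rewrite /r (bigD1 f)//= lerDl sumr_ge0. Qed.

Lemma sum_tuple_prod k : \sum_(s : k.-tuple F) \prod_(x <- s) r x = (\sum_x r x) ^+ k.
Proof.
elim: k => [|k IH].
  rewrite (bigD1 [tuple])//= big_nil expr0 big1 ?addr0// => s.
  by rewrite [s]tuple0.
rewrite sum_tupleS exprS -IH mulr_suml; apply: eq_bigr => g _.
by rewrite mulr_sumr; apply: eq_bigr => s _; rewrite big_cons.
Qed.

Lemma path_prod_le (s t : seq F) : size s = size t ->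
  \prod_(p <- zip s t) w p.1 p.2 <= \prod_(x <- s) r x.
Proof.
elim: s t => [|x s IH] [|y t] //=; first by rewrite !big_nil.
move=> [st].
rewrite !big_cons /=; apply: ler_pM => //; last exact: IH.
by apply: prodr_ge0.
Qed.

Lemma sum_path_le k :
  \sum_(s : k.-tuple F) \prod_(p <- zip s (rot 1 s)) w p.1 p.2 <= (\sum_x r x) ^+ k.
Proof.
rewrite -sum_tuple_prod; apply: ler_sum => s _; apply: path_prod_le.
by rewrite size_rot.
Qed.

(* Repeated indices give a zero determinant; distinct ones allow bounding the
   permanent by the product of the full row sums. *)
Lemma det_le k (s : k.-tuple F) :
  nc (\det (\matrix_(i < k, j < k) ((w (tnth s i) (tnth s j))%:C : R[i]))) <=
  \prod_(x <- s) r x.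
Proof.
have [us|nus] := boolP (uniq s); last first.
  have /injectivePn[i [j ij e]] : ~~ injectiveb (tnth s).
    by apply: contra nus => /injectiveP/tuple_uniqP.
  rewrite (determinant_alternate ij) ?nc0; first exact: prodr_ge0.
  by move=> l; rewrite !mxE e.
apply: le_trans (nc_sum _ _ _) _.
pose G (f : {ffun 'I_k -> 'I_k}) := \prod_i w (tnth s i) (tnth s (f i)).
apply: (@le_trans _ _ (\sum_(f : {ffun 'I_k -> 'I_k}) G f)).
  (* Permutations are among all self-maps of 'I_k, and the sum over all self-maps factors by
     distributivity. *)
  apply: (@le_trans _ _ (\sum_(f <- map (@pval 'I_k) (index_enum {perm 'I_k})) G f)).
    rewrite big_map; apply: ler_sum => g _; rewrite ncM ncX ncN nc1 expr1n mul1r.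
    rewrite nc_prod; apply: ler_prod => i _.
    by rewrite nc_ge0 mxE nc_real ger0_norm// pvalE lexx.
  apply: ler_sum_sub.
  - by rewrite map_inj_uniq ?index_enum_uniq//; exact: val_inj.
  - exact: index_enum_uniq.
  - by move=> f _; rewrite mem_index_enum.
  - by move=> f; exact: prodr_ge0.
rewrite -(bigA_distr_bigA (fun i j => w (tnth s i) (tnth s j))) big_tuple.
apply: ler_prod => i _; rewrite sumr_ge0//=.
rewrite -(big_tuple _ _ s predT (fun y => w (tnth s i) y)).
apply: ler_sum_sub => //; first exact: index_enum_uniq.
Qed.

Lemma sum_det_le k :
  \sum_(s : k.-tuple F)
    nc (\det (\matrix_(i < k, j < k) ((w (tnth s i) (tnth s j))%:C : R[i]))) <=
  (\sum_x r x) ^+ k.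
Proof. by rewrite -sum_tuple_prod; apply: ler_sum => s _; exact: det_le. Qed.

End FiniteBounds.

(** * The coefficients of det(1 - uT) over an arbitrary edge set *)

Section FredholmCoefficients.
Context {R : realType} {X : oriented_graph}.
Local Notation E := (edge X).
Variables (w : E -> E -> R) (W : R).
Hypothesis w0 : forall e f, 0 <= w e f.
Hypothesis wW : forall s : seq (E * E), uniq s -> \sum_(p <- s) w p.1 p.2 <= W.

Definition minor k (s : k.-tuple E) : R[i] :=
  \det (\matrix_(i < k, j < k) (w (tnth s i) (tnth s j))%:C).

Definition pweight k (s : k.-tuple E) : R[i] := (path_weight w s)%:C.

Lemma W_ge0 : 0 <= W.
Proof. by have := @wW [::] isT; rewrite big_nil. Qed.

Let wA (A : {fset E}) (x y : A) : R := w (val x) (val y).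

Lemma restricted_sum_le (A : {fset E}) : \sum_(x : A) \sum_(y : A) wA x y <= W.
Proof.
rewrite pair_big /=.
have := @wW (map (fun p : A * A => (val p.1, val p.2)) (index_enum (A * A)%type)).
rewrite big_map; apply; rewrite map_inj_uniq ?index_enum_uniq//.
by move=> [a b] [c d] [/val_inj -> /val_inj ->].
Qed.

Lemma restricted_sum_ge0 (A : {fset E}) : 0 <= \sum_(x : A) \sum_(y : A) wA x y.
Proof. by apply: sumr_ge0 => x _; apply: sumr_ge0 => y _; exact: w0. Qed.

Lemma minor_incl k (A : {fset E}) (s : k.-tuple A) :
  minor (incl s) = \det (\matrix_(i < k, j < k) (wA (tnth s i) (tnth s j))%:C).
Proof. by congr (\det _); apply/matrixP => i j; rewrite !mxE !tnth_map. Qed.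

Lemma zip_map_val (A : {fset E}) (s t : seq A) :
  zip (map val s) (map val t) = map (fun p => (val p.1, val p.2)) (zip s t).
Proof. by elim: s t => [|x s IH] [|y t] //=; rewrite IH. Qed.

Lemma path_weight_incl k (A : {fset E}) (s : k.-tuple A) :
  path_weight w (incl s) = \prod_(p <- zip s (rot 1 s)) wA p.1 p.2.
Proof. by rewrite /path_weight /= -map_rot zip_map_val big_map. Qed.

Lemma minor_bsum k : bsum (@minor k) (W ^+ k).
Proof.
apply: bsum_tuples => A; under eq_bigr do rewrite minor_incl.
apply: le_trans (sum_det_le _ k) _; first by move=> x y; exact: w0.
by rewrite lerXn2r ?nnegrE ?W_ge0 ?restricted_sum_ge0 ?restricted_sum_le.
Qed.

Lemma path_weight_ge0 (s : seq E) : 0 <= path_weight w s.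
Proof. by rewrite /path_weight prodr_ge0. Qed.

Lemma pweight_bsum k : bsum (@pweight k) (W ^+ k).
Proof.
apply: bsum_tuples => A.
under eq_bigr do rewrite nc_real ger0_norm ?path_weight_ge0// path_weight_incl.
apply: le_trans (sum_path_le _ k) _; first by move=> x y; exact: w0.
by rewrite lerXn2r ?nnegrE ?W_ge0 ?restricted_sum_ge0 ?restricted_sum_le.
Qed.

Definition minor_total k : R[i] := csum (@minor k).
Definition trace_total k : R[i] := csum (@pweight k).
Definition fredholm_coef n : R[i] := (-1) ^+ n * minor_total n / n`!%:R.

Lemma minor_total_has_sum k : has_sum (@minor k) (minor_total k).
Proof. by apply: asum_has_sum; exists (W ^+ k); exact: minor_bsum. Qed.

Lemma trace_total_has_sum k : has_sum (@pweight k) (trace_total k).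
Proof. by apply: asum_has_sum; exists (W ^+ k); exact: pweight_bsum. Qed.

(** Both sides are limits over finite sets A of edges, and for each A the identity is
    [fredholm_newton] for the weight restricted to A. *)
Lemma minor_total_newton n : minor_total n.+1 = \sum_(j < n.+1)
  (-1) ^+ j * (n ^_ j)%:R * minor_total (n - j) * trace_total j.+1.
Proof.
refine (cvgc_unique (has_sum_tuples (@minor_total_has_sum n.+1)) _).
have h : cvgc totally (fun A : {fset E} => \sum_(j < n.+1)
    (-1) ^+ j * (n ^_ j)%:R * (\sum_(s : (n - j).-tuple A) minor (incl s)) *
    \sum_(s : j.+1.-tuple A) pweight (incl s))
  (\sum_(j < n.+1)
    (-1) ^+ j * (n ^_ j)%:R * minor_total (n - j) * trace_total j.+1).
  apply: cvgc_sum => j _; apply: cvgcM.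
    by apply: cvgcZ; apply: has_sum_tuples; exact: minor_total_has_sum.
  by apply: has_sum_tuples; exact: trace_total_has_sum.
apply: eq_cvgc h => A; apply/esym.
have := @fredholm_newton R[i] A (fun x y => (wA x y)%:C) n.
under eq_bigr do rewrite -minor_incl.
move=> ->; apply: eq_bigr => j _; congr (_ * _ * _).
  by apply: eq_bigr => s _; rewrite -minor_incl.
by apply: eq_bigr => s _; rewrite /pweight path_weight_incl rmorph_prod.
Qed.

Lemma minor_total0 : minor_total 0 = 1.
Proof.
apply: has_sum_unique.
have := @has_sum_singleton R _ (@minor 0) [tuple].
rewrite /minor det_mx00; apply=> s.
by rewrite [s]tuple0.
Qed.

Lemma fredholm_coef0 : fredholm_coef 0 = 1.
Proof. by rewrite /fredholm_coef minor_total0 expr0 fact0 mul1r divr1. Qed.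

Lemma fredholm_coef_newton n : n.+1%:R * fredholm_coef n.+1 =
  - \sum_(j < n.+1) trace_total j.+1 * fredholm_coef (n - j).
Proof.
rewrite /fredholm_coef factS natrM minor_total_newton.
have n0 : n.+1%:R != 0 :> R[i] by rewrite pnatr_eq0.
have f0 k : k`!%:R != 0 :> R[i] by rewrite pnatr_eq0 -lt0n fact_gt0.
rewrite invfM mulrA mulrCA mulrA [n.+1%:R * _]mulrC !mulrA.
rewrite mulr_sumr !mulr_suml -sumrN; apply: eq_bigr => j _.
have jn : (j <= n)%N by rewrite -ltnS.
(* This cancels the falling factorial and leaves the normalisation of [fredholm_coef (n - j)]. *)
have -> : n`!%:R = (n ^_ j)%:R * (n - j)`!%:R :> R[i] by rewrite -natrM ffact_fact.
have p0 : (n ^_ j)%:R != 0 :> R[i] by rewrite pnatr_eq0 -lt0n ffact_gt0.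
have -> : (-1) ^+ n.+1 = - ((-1) ^+ j * (-1) ^+ (n - j)) :> R[i].
  by rewrite -exprD subnKC// exprS mulN1r.
have jj : (-1) ^+ j * (-1) ^+ j = 1 :> R[i] by rewrite -exprD addnn -signr_odd odd_double.
(* The signs become opaque variables for [field], so the fact that (-1)^j squares to 1 is supplied
   by hand. *)
move: jj p0 (f0 (n - j)%N) n0; move: ((-1) ^+ j) ((-1) ^+ (n - j)) => a b.
move: (minor_total _) (trace_total _) (_`!%:R) (_ ^_ _)%:R n.+1%:R => m t f p n1.
move=> jj p0 g0 n0; rewrite -[RHS]mul1r -jj; field.
by rewrite p0 g0 n0.
Qed.

Lemma fredholm_coef_bound n : nc (fredholm_coef n) <= W ^+ n / n`!%:R.
Proof.
rewrite /fredholm_coef !ncM ncX ncN nc1 expr1n mul1r ncV nc_nat.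
by rewrite ler_wpM2r ?invr_ge0// csum_le//; exact: minor_bsum.
Qed.

Lemma fredholm_coef_geometric n : nc (fredholm_coef n) <= W ^+ n.
Proof.
apply: le_trans (fredholm_coef_bound n) _.
by rewrite ler_pdivrMr ?ltr0n ?fact_gt0// ler_peMr ?exprn_ge0 ?W_ge0// ler1n fact_gt0.
Qed.

Lemma fredholm_coef_entire : entire_coef fredholm_coef.
Proof.
(* W^n x^n / n! is a term of the nonnegative exponential series at W x, hence at most its sum. *)
move=> x x0; exists (expR (W * x)) => n.
have y0 : 0 <= W * x by rewrite mulr_ge0 ?W_ge0.
apply: (@le_trans _ _ (exp_coeff (W * x) n)).
  rewrite /exp_coeff /= exprMn mulrAC ler_wpM2r ?exprn_ge0//.
  exact: fredholm_coef_bound.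
apply: (@le_trans _ _ (series (exp_coeff (W * x)) n.+1)).
  by rewrite seriesEnat /= big_nat_recr//= lerDr sumr_ge0// => i _; exact: exp_coeff_ge0.
apply: nondecreasing_cvgn_le; last exact: is_cvg_series_exp_coeff.
apply/nondecreasing_seqP => m; rewrite seriesSr lerDl; exact: exp_coeff_ge0.
Qed.

End FredholmCoefficients.

(** * The Hilbert space of square-summable functions *)

Section NonnegativeSums.
Context {R : realType} {I : choiceType}.
Variable g : I -> R.
Hypothesis g0 : forall i, 0 <= g i.

Lemma esum_ge_sum (s : seq I) : uniq s ->
  ((\sum_(i <- s) g i)%:E <= \esum_(i in [set: I]) (g i)%:E)%E.
Proof.
move=> us; apply: esum_ge; exists [set` s]; first by split.
rewrite fsbig_finite//= -sumEFin le_eqVlt; apply/orP; left; apply/eqP.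
apply: perm_big; apply: uniq_perm; rewrite ?fset_uniq// => i.
by rewrite in_fset_set// -[RHS]/(_ \in [set` s]) mem_setE.
Qed.

Lemma esum_le_bound (M : R) : (forall s : seq I, uniq s -> \sum_(i <- s) g i <= M) ->
  (\esum_(i in [set: I]) (g i)%:E <= M%:E)%E.
Proof.
move=> h; apply: ub_ereal_sup => _ [A [fA _] <-].
by rewrite fsbig_finite// sumEFin lee_fin h// fset_uniq.
Qed.

Lemma nonneg_csum (M : R) : (forall s : seq I, uniq s -> \sum_(i <- s) g i <= M) ->
  exists t : R, [/\ csum (fun i => (g i)%:C) = t%:C,
    has_sum (fun i => (g i)%:C) t%:C &
    forall s : seq I, uniq s -> \sum_(i <- s) g i <= t].
Proof.
move=> gM; have [t ht] := nonneg_has_sum g0 gM; exists t; split=> //.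
  exact: has_sum_unique.
move=> s us; apply/ler_addgt0Pr => e e0.
have [A0 hA0] := (has_sumP _ _).1 ht _ e0.
have := hA0 ([fset x in s] `|` A0)%fset (fsubsetUr _ _).
rewrite -rmorph_sum -rmorphB nc_real => /ltW; rewrite ler_norml => /andP[_].
rewrite lerBlDl => h; apply: le_trans h; apply: ler_sum_sub => // i si.
by rewrite !inE si.
Qed.

End NonnegativeSums.

Section HilbertSpace.
Context {R : realType} {E : choiceType}.
Implicit Types (phi psi eta : E -> R[i]) (N M : R).

(* The finite-sum form of [l2_norm phi <= N]; it passes to pointwise limits. *)
Definition l2_le phi N : Prop :=
  0 <= N /\ forall s : seq E, uniq s -> \sum_(e <- s) nc (phi e) ^+ 2 <= N ^+ 2.

Lemma l2_le_l2 phi N : l2_le phi N -> l2 phi.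
Proof.
move=> [_ h]; apply: le_lt_trans (ltry (N ^+ 2)).
by apply: esum_le_bound.
Qed.

Lemma sq_norm_ge0 phi : (0 <= sq_norm phi)%E.
Proof. by apply: esum_ge0 => e _; rewrite lee_fin sqr_ge0. Qed.

Lemma l2_le_norm phi : l2 phi -> l2_le phi (l2_norm phi).
Proof.
move=> h; split=> [|s us]; first exact: sqrtr_ge0.
have fin : sq_norm phi \is a fin_num by rewrite ge0_fin_numE ?sq_norm_ge0.
rewrite sqr_sqrtr ?fine_ge0 ?sq_norm_ge0// -lee_fin fineK//.
by apply: esum_ge_sum.
Qed.

Lemma norm_le phi N : l2_le phi N -> l2_norm phi <= N.
Proof.
move=> hN; have [N0 h] := hN; have l := l2_le_l2 hN.
have fin : sq_norm phi \is a fin_num by rewrite ge0_fin_numE ?sq_norm_ge0.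
rewrite -(ler_pXn2r (n := 2))// ?nnegrE ?sqrtr_ge0//.
rewrite sqr_sqrtr ?fine_ge0 ?sq_norm_ge0// -lee_fin fineK//.
exact: esum_le_bound.
Qed.

Lemma l2_norm_ge0 phi : 0 <= l2_norm phi.
Proof. exact: sqrtr_ge0. Qed.

Lemma l2_le_mono phi N M : l2_le phi N -> N <= M -> l2_le phi M.
Proof.
move=> [N0 h] NM; have M0 := le_trans N0 NM; split=> // s us.
by apply: le_trans (h s us) _; rewrite lerXn2r.
Qed.

Lemma l2_le_point phi N e : l2_le phi N -> nc (phi e) <= N.
Proof.
move=> [N0 /(_ [:: e] isT)]; rewrite big_seq1 => h.
by rewrite -(ler_pXn2r (n := 2))// ?nnegrE ?nc_ge0.
Qed.

(** Cauchy-Schwarz with prescribed bounds in place of the norms. *)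
Lemma sum_mul_le (s : seq E) (a b : E -> R) N M :
  (forall e, 0 <= a e) -> (forall e, 0 <= b e) -> 0 <= N -> 0 <= M ->
  \sum_(e <- s) a e ^+ 2 <= N ^+ 2 -> \sum_(e <- s) b e ^+ 2 <= M ^+ 2 ->
  \sum_(e <- s) a e * b e <= N * M.
Proof.
move=> a0 b0 N0 M0 aN bM.
have z (c : E -> R) : \sum_(e <- s) c e ^+ 2 <= 0 ^+ 2 -> forall e, e \in s -> c e = 0.
  rewrite expr0n /= => h e es; apply/eqP; rewrite -sqrf_eq0 eq_le sqr_ge0 andbT.
  by apply: le_trans h; rewrite (big_rem e)//= lerDl sumr_ge0// => i _; exact: sqr_ge0.
have [N00|Np] := eqVneq N 0.
  rewrite N00 in aN *; rewrite mul0r big_seq big1// => e es.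
  by rewrite (z _ aN e es) mul0r.
have [M00|Mp] := eqVneq M 0.
  rewrite M00 in bM *; rewrite mulr0 big_seq big1// => e es.
  by rewrite (z _ bM e es) mulr0.
have {}Np : 0 < N by rewrite lt_neqAle eq_sym Np.
have {}Mp : 0 < M by rewrite lt_neqAle eq_sym Mp.
(* The arithmetic-geometric inequality, with weights chosen so that each half contributes N M / 2;
   the cases N = 0 and M = 0 were separated because of these quotients. *)
apply: (@le_trans _ _ (\sum_(e <- s) (M / N / 2 * a e ^+ 2 + N / M / 2 * b e ^+ 2))).
  apply: ler_sum => e _; rewrite -subr_ge0.
  have -> : M / N / 2 * a e ^+ 2 + N / M / 2 * b e ^+ 2 - a e * b e =
     (M * a e - N * b e) ^+ 2 / (2 * N * M).
    by field; rewrite !gt_eqF.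
  by rewrite divr_ge0 ?sqr_ge0// !mulr_ge0.
rewrite big_split -!mulr_sumr /=.
have -> : N * M = M / N / 2 * N ^+ 2 + N / M / 2 * M ^+ 2 by field; rewrite !gt_eqF.
by apply: lerD; apply: ler_wpM2l => //; rewrite !divr_ge0.
Qed.

Lemma l2_leD phi psi N M : l2_le phi N -> l2_le psi M ->
  l2_le (fun e => phi e + psi e) (N + M).
Proof.
move=> [N0 hN] [M0 hM]; split=> [|s us]; first exact: addr_ge0.
apply: (@le_trans _ _ (\sum_(e <- s) (nc (phi e) ^+ 2 + nc (psi e) ^+ 2 +
    2 * (nc (phi e) * nc (psi e))))).
  apply: ler_sum => e _; have := ncD (phi e) (psi e).
  have -> : nc (phi e) ^+ 2 + nc (psi e) ^+ 2 + 2 * (nc (phi e) * nc (psi e)) =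
    (nc (phi e) + nc (psi e)) ^+ 2 by ring.
  by move=> h; rewrite lerXn2r ?nnegrE ?addr_ge0 ?nc_ge0.
rewrite !big_split -mulr_sumr /=.
have -> : (N + M) ^+ 2 = N ^+ 2 + M ^+ 2 + 2 * (N * M) by ring.
apply: lerD; first exact: lerD (hN _ us) (hM _ us).
apply: ler_wpM2l => //; apply: sum_mul_le => //; try by move=> e; exact: nc_ge0.
  exact: hN.
exact: hM.
Qed.

Lemma l2_leZ phi N c : l2_le phi N -> l2_le (fun e => c * phi e) (nc c * N).
Proof.
move=> [N0 hN]; split=> [|s us]; first by rewrite mulr_ge0 ?nc_ge0.
under eq_bigr do rewrite ncM exprMn.
by rewrite -mulr_sumr exprMn ler_wpM2l ?sqr_ge0 ?hN.
Qed.

Lemma l2_leB phi psi N M : l2_le phi N -> l2_le psi M ->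
  l2_le (fun e => phi e - psi e) (N + M).
Proof.
move=> hN hM; have := l2_leD hN (l2_leZ (-1) hM); rewrite ncN nc1 mul1r.
by under eq_fun do rewrite mulN1r.
Qed.

Lemma eq_l2_le phi psi N : phi =1 psi -> l2_le phi N -> l2_le psi N.
Proof. by move=> /funext ->. Qed.

Lemma l2_le0 N : 0 <= N -> l2_le (fun=> 0) N.
Proof.
by move=> N0; split=> // s us; rewrite big1 ?sqr_ge0// => e _; rewrite nc0 expr0n.
Qed.

Lemma cvgc_conj (T : Type) (F : set_system T) {FF : Filter F} (f : T -> R[i]) s :
  cvgc F f s -> cvgc F (fun x => (f x)^*%C) s^*%C.
Proof.
move=> h e /h; apply: filterS => x; by rewrite -rmorphB nc_conj.
Qed.

Lemma l2_le_lim (T : Type) (F : set_system T) {FF : ProperFilter F}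
    (f : T -> E -> R[i]) phi N :
  (forall e, cvgc F (fun x => f x e) (phi e)) -> (forall x, l2_le (f x) N) -> l2_le phi N.
Proof.
move=> h fN; have [x _] := filter_ex (@filterT _ F _).
have [N0 _] := fN x; split=> // s us.
(* Written with conjugates, a finite sum of squares passes to the limit by the sum and product
   rules. *)
have sE (psi : E -> R[i]) : ((\sum_(e <- s) nc (psi e) ^+ 2)%:C : R[i]) =
    \sum_(e <- s) psi e * (psi e)^*%C.
  by rewrite rmorph_sum; apply: eq_bigr => e _; rewrite -nc_sqr.
have sN (psi : E -> R[i]) : nc (\sum_(e <- s) psi e * (psi e)^*%C) =
    \sum_(e <- s) nc (psi e) ^+ 2.
  by rewrite -sE nc_real ger0_norm// sumr_ge0// => e _; exact: sqr_ge0.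
rewrite -sN; apply: (@cvgc_le _ _ F _ (fun x => \sum_(e <- s) f x e * (f x e)^*%C)).
  by apply: cvgc_sum => e _; apply: cvgcM; [exact: h|apply: cvgc_conj; exact: h].
by apply: nearW => y; rewrite sN; have [_] := fN y; apply.
Qed.

Lemma inner_bsum phi psi N M : l2_le phi N -> l2_le psi M ->
  bsum (fun e => phi e * (psi e)^*%C) (N * M).
Proof.
move=> [N0 hN] [M0 hM] s us; under eq_bigr do rewrite ncM nc_conj.
by apply: sum_mul_le => //; try (by move=> e; exact: nc_ge0); [exact: hN|exact: hM].
Qed.

Lemma inner_asum phi psi : l2 phi -> l2 psi -> asum (fun e => phi e * (psi e)^*%C).
Proof. by move=> /l2_le_norm h1 /l2_le_norm h2; eexists; exact: inner_bsum h1 h2. Qed.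

Lemma inner_le phi psi N M : l2_le phi N -> l2_le psi M -> nc (inner phi psi) <= N * M.
Proof. by move=> h1 h2; apply: csum_le; exact: inner_bsum. Qed.

Lemma innerC phi psi : l2 phi -> l2 psi -> inner psi phi = (inner phi psi)^*%C.
Proof.
move=> h1 h2; rewrite /inner -csum_conj; last exact: inner_asum.
by congr csum; apply/funext => e; rewrite rmorphM /= conjcK mulrC.
Qed.

Lemma inner_linl (a : R[i]) phi psi eta : l2 phi -> l2 psi -> l2 eta ->
  inner (fun e => a * phi e + psi e) eta = a * inner phi eta + inner psi eta.
Proof.
move=> h1 h2 h3; rewrite /inner -csumZ; last exact: inner_asum.
rewrite -csumD; [|by apply: asumZ; exact: inner_asum|exact: inner_asum].
by congr csum; apply/funext => e; rewrite mulrDl mulrA.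
Qed.

Lemma innerDl phi psi eta : l2 phi -> l2 psi -> l2 eta ->
  inner (fun e => phi e + psi e) eta = inner phi eta + inner psi eta.
Proof.
move=> h1 h2 h3; rewrite -[inner phi eta]mul1r -inner_linl//; congr inner.
by apply/funext => e; rewrite mul1r.
Qed.

Lemma innerZl (a : R[i]) phi eta : l2 phi -> l2 eta ->
  inner (fun e => a * phi e) eta = a * inner phi eta.
Proof.
move=> h1 h3; rewrite /inner -csumZ; last exact: inner_asum.
by congr csum; apply/funext => e; rewrite mulrA.
Qed.

Lemma l2Z (a : R[i]) phi : l2 phi -> l2 (fun e => a * phi e).
Proof. by move=> /l2_le_norm h; exact: l2_le_l2 (l2_leZ a h). Qed.

Lemma l2D phi psi : l2 phi -> l2 psi -> l2 (fun e => phi e + psi e).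
Proof. by move=> /l2_le_norm h1 /l2_le_norm h2; exact: l2_le_l2 (l2_leD h1 h2). Qed.

Lemma l2B phi psi : l2 phi -> l2 psi -> l2 (fun e => phi e - psi e).
Proof. by move=> /l2_le_norm h1 /l2_le_norm h2; exact: l2_le_l2 (l2_leB h1 h2). Qed.

Lemma innerBl phi psi eta : l2 phi -> l2 psi -> l2 eta ->
  inner (fun e => phi e - psi e) eta = inner phi eta - inner psi eta.
Proof.
move=> h1 h2 h3; have := inner_linl (-1) h2 h1 h3.
rewrite mulN1r addrC => <-; congr inner; apply/funext => e.
by rewrite mulN1r addrC.
Qed.

Lemma innerDr phi psi eta : l2 phi -> l2 psi -> l2 eta ->
  inner eta (fun e => phi e + psi e) = inner eta phi + inner eta psi.
Proof.
move=> h1 h2 h3; have h := l2D h1 h2.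
by rewrite innerC// innerDl// rmorphD /= -!innerC.
Qed.

Lemma innerBr phi psi eta : l2 phi -> l2 psi -> l2 eta ->
  inner eta (fun e => phi e - psi e) = inner eta phi - inner eta psi.
Proof.
move=> h1 h2 h3; have h := l2B h1 h2.
by rewrite innerC// innerBl// rmorphB /= -!innerC.
Qed.

Lemma innerZr (a : R) phi eta : l2 phi -> l2 eta ->
  inner eta (fun e => a%:C * phi e) = a%:C * inner eta phi.
Proof.
move=> h1 h3; have h := l2Z a%:C h1.
rewrite innerC// innerZl// rmorphM /= -innerC//; congr (_ * _).
exact: conjc_real.
Qed.

Lemma inner0l (eta : E -> R[i]) : inner (fun=> 0) eta = 0.
Proof.
apply: has_sum_unique.
have := @has_sum_fin R _ (fun e => (0 : R[i]) * (eta e)^*%C) [::] isT.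
by rewrite big_nil; apply=> e _; rewrite mul0r.
Qed.

Lemma inner0r (eta : E -> R[i]) : inner eta (fun=> 0) = 0.
Proof.
apply: has_sum_unique.
have := @has_sum_fin R _ (fun e => eta e * (0 : R[i])^*%C) [::] isT.
by rewrite big_nil; apply=> e _; rewrite conjc0 mulr0.
Qed.

Lemma l2_lin (a : R[i]) phi psi : l2 phi -> l2 psi -> l2 (fun e => a * phi e + psi e).
Proof.
by move=> /l2_le_norm h1 /l2_le_norm h2; apply: l2_le_l2 (l2_leD (l2_leZ a h1) h2).
Qed.

Lemma inner_linr (a : R[i]) phi psi eta : l2 phi -> l2 psi -> l2 eta ->
  inner eta (fun e => a * phi e + psi e) = a^*%C * inner eta phi + inner eta psi.
Proof.
move=> h1 h2 h3; rewrite innerC//; last exact: l2_lin.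
by rewrite inner_linl// rmorphD rmorphM /= -!innerC.
Qed.

Lemma inner_self phi : l2 phi -> inner phi phi = (l2_norm phi ^+ 2)%:C.
Proof.
move=> h; have [N0 hN] := l2_le_norm h.
have [t [tE ht tmax]] := nonneg_csum (fun e => sqr_ge0 (nc (phi e))) hN.
rewrite /inner; under [X in csum X]eq_fun do rewrite -nc_sqr.
rewrite tE; congr (_%:C); apply/eqP; rewrite eq_le; apply/andP; split.
  have t0 : 0 <= t by have := tmax [::] isT; rewrite big_nil.
  have := has_sum_le ht; rewrite nc_real ger0_norm//; apply=> s us.
  by under eq_bigr do rewrite nc_real ger0_norm ?sqr_ge0//; exact: hN.
have t0 : 0 <= t by have := tmax [::] isT; rewrite big_nil.
have : l2_norm phi <= Num.sqrt t.
  by apply: norm_le; split=> [|s us]; rewrite ?sqrtr_ge0 ?sqr_sqrtr ?tmax.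
move=> hh; rewrite -(sqr_sqrtr t0).
by rewrite lerXn2r ?nnegrE ?sqrtr_ge0.
Qed.

Lemma inner_basis phi e : inner phi (basis_vec R e) = phi e.
Proof.
apply: has_sum_unique.
have := @has_sum_singleton R _ (fun f => phi f * (basis_vec R e f)^*%C) e.
have -> : basis_vec R e e = 1 by rewrite /basis_vec eqxx.
rewrite conjc1 mulr1; apply=> f /negPf fe.
by rewrite /basis_vec fe conjc0 mulr0.
Qed.

Lemma l2_le_basis e : l2_le (basis_vec R e) 1.
Proof.
split=> // s us; rewrite expr1n (bigID (fun f => f == e)) /= [X in _ + X]big1; last first.
  by move=> f /negPf fe; rewrite /basis_vec fe nc0 expr0n.
rewrite addr0; under eq_bigr => f fe do rewrite /basis_vec fe nc1 expr1n.
rewrite big_const_seq iter_addr addr0 -/(count_mem e s) count_uniq_mem//.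
by case: (e \in s).
Qed.

End HilbertSpace.

(** * Absolute values of operators *)

Section Operators.
Context {R : realType} {E : choiceType}.
Implicit Types (phi psi : E -> R[i]) (N M : R) (A B : operator R E).

Definition l2_linear A : Prop := forall (a : R[i]) phi psi, l2 phi -> l2 psi ->
  A (fun e => a * phi e + psi e) = (fun e => a * A phi e + A psi e).

Definition l2_bounded A M : Prop := forall phi N, l2_le phi N -> l2_le (A phi) (M * N).

Definition l2_adjoint A B : Prop := forall phi psi, l2 phi -> l2 psi ->
  inner (A phi) psi = inner phi (B psi).

Lemma bnd_l2 A M phi : l2_bounded A M -> l2 phi -> l2 (A phi).
Proof. by move=> h /l2_le_norm/h/l2_le_l2. Qed.

Lemma bounded_operatorP A M : l2_linear A -> l2_bounded A M -> bounded_operator A.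
Proof.
move=> lA bA; split=> //; exists M => phi hphi; have h := bA _ _ (l2_le_norm hphi).
by split; [exact: l2_le_l2 h|exact: norm_le].
Qed.

Lemma linB A phi psi : l2_linear A -> l2 phi -> l2 psi ->
  A (fun e => phi e - psi e) = (fun e => A phi e - A psi e).
Proof.
move=> lA h1 h2; have := lA (-1) psi phi h2 h1.
have -> : (fun e => -1 * psi e + phi e) = (fun e => phi e - psi e).
  by apply/funext => e; rewrite mulN1r addrC.
by move=> ->; apply/funext => e; rewrite mulN1r addrC.
Qed.

Lemma adj_sym A B M : l2_bounded A M -> l2_bounded B M ->
  l2_adjoint A B -> l2_adjoint B A.
Proof.
move=> bA bB h phi psi h1 h2.
rewrite innerC//; last exact: bnd_l2 bB _.
by rewrite -h// -innerC//; exact: bnd_l2 bA _.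
Qed.

End Operators.

(** * Operators with a nonnegative summable kernel *)

Section Kernels.
Context {R : realType} {E : choiceType}.
Variables (K : E -> E -> R) (W : R).
Hypothesis K0 : forall e f, 0 <= K e f.
Hypothesis KW : forall s : seq (E * E), uniq s -> \sum_(p <- s) K p.1 p.2 <= W.

(** For K = w this is [bass_operator w] by conversion; a general kernel also covers the adjoint,
    given by the transposed kernel. *)
Definition kernel_op : operator R E := fun phi f => csum (fun e => phi e * (K e f)%:C).

Lemma kernel_rect_le (s t : seq E) : uniq s -> uniq t ->
  \sum_(e <- s) \sum_(f <- t) K e f <= W.
Proof.
move=> us ut; have := @KW [seq (e, f) | e <- s, f <- t].
rewrite big_allpairs_dep; apply; apply: allpairs_uniq => //.
by move=> [a b] [c d].
Qed.

(** The l^2 norm is at most the l^1 norm, since the mixed products are nonnegative. *)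
Lemma sum_sqr_le (s : seq E) (a : E -> R) : (forall e, 0 <= a e) ->
  \sum_(e <- s) a e ^+ 2 <= (\sum_(e <- s) a e) ^+ 2.
Proof.
move=> a0; elim: s => [|e s IH]; first by rewrite !big_nil expr0n.
rewrite !big_cons sqrrD -addrA lerD2l (le_trans IH)// lerDr mulrn_wge0//.
by rewrite mulr_ge0// sumr_ge0.
Qed.

Lemma kernel_col_bsum phi N f : l2_le phi N -> bsum (fun e => phi e * (K e f)%:C) (N * W).
Proof.
move=> hN s us; have [N0 _] := hN.
apply: (@le_trans _ _ (\sum_(e <- s) N * K e f)).
  apply: ler_sum => e _; rewrite ncM nc_real ger0_norm// ler_wpM2r//.
  exact: l2_le_point.
rewrite -mulr_sumr ler_wpM2l//.
have := @kernel_rect_le s [:: f] us isT.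
by under eq_bigr do rewrite big_seq1.
Qed.

Lemma kernel_asum phi f : l2 phi -> asum (fun e => phi e * (K e f)%:C).
Proof. by move=> /l2_le_norm h; eexists; exact: kernel_col_bsum h. Qed.

Lemma kernel_lin : l2_linear kernel_op.
Proof.
move=> a phi psi h1 h2; apply/funext => f; rewrite /kernel_op.
rewrite -csumZ; last exact: kernel_asum.
rewrite -csumD; [|by apply: asumZ; exact: kernel_asum|exact: kernel_asum].
by congr csum; apply/funext => e; rewrite mulrDl mulrA.
Qed.

(** As |phi e| <= N at every point, the value at f is at most N times the f-th column sum; the l^1
    norm of these bounds is at most N W. Truncation to finite sets of e keeps all sums finite. *)
Lemma kernel_bnd : l2_bounded kernel_op W.
Proof.
move=> phi N hN; have [N0 _] := hN.
have W0 : 0 <= W by have := @KW [::] isT; rewrite big_nil.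
apply: (@l2_le_lim _ _ _ totally _
  (fun (A : {fset E}) f => \sum_(e <- A) phi e * (K e f)%:C)) => [f|A].
  by apply/has_sumE; apply: asum_has_sum; exact: kernel_asum (l2_le_l2 hN).
split=> [|s us]; first exact: mulr_ge0.
apply: (@le_trans _ _ (\sum_(f <- s) (N * \sum_(e <- A) K e f) ^+ 2)).
  apply: ler_sum => f _.
  have h : nc (\sum_(e <- A) phi e * (K e f)%:C) <= N * \sum_(e <- A) K e f.
    apply: le_trans (nc_sum _ _ _) _; rewrite mulr_sumr; apply: ler_sum => e _.
    by rewrite ncM nc_real ger0_norm// ler_wpM2r//; exact: l2_le_point.
  by rewrite lerXn2r ?nnegrE ?nc_ge0// mulr_ge0// sumr_ge0.
apply: le_trans (sum_sqr_le _ _) _; first by move=> f; rewrite mulr_ge0// sumr_ge0.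
rewrite -mulr_sumr lerXn2r ?nnegrE ?mulr_ge0//.
  by apply: sumr_ge0 => f _; exact: sumr_ge0.
rewrite mulrC ler_wpM2r// exchange_big; exact: kernel_rect_le.
Qed.

End Kernels.

Section KernelAdjoint.
Context {R : realType} {E : choiceType}.
Variables (K : E -> E -> R) (W : R).
Hypothesis K0 : forall e f, 0 <= K e f.
Hypothesis KW : forall s : seq (E * E), uniq s -> \sum_(p <- s) K p.1 p.2 <= W.

Lemma transpose_le (s : seq (E * E)) : uniq s -> \sum_(p <- s) K p.2 p.1 <= W.
Proof.
move=> us; have := @KW (map (fun p => (p.2, p.1)) s); rewrite big_map; apply.
by rewrite map_inj_uniq// => -[a b] [c d] [-> ->].
Qed.

(** An exchange of summations, justified because the double family is at most |phi| |psi| K(e, f) in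
    modulus. *)
Lemma kernel_adj : l2_adjoint (kernel_op K) (kernel_op (fun e f => K f e)).
Proof.
move=> phi psi h1 h2; have [N0 hN] := l2_le_norm h1; have [M0 hM] := l2_le_norm h2.
have K0' e f : 0 <= K f e by [].
pose h e f := phi e * (K e f)%:C * (psi f)^*%C.
have ha : asum (fun p : E * E => h p.1 p.2).
  exists (l2_norm phi * l2_norm psi * W) => s us.
  apply: (@le_trans _ _ (\sum_(p <- s) l2_norm phi * l2_norm psi * K p.1 p.2)).
    apply: ler_sum => -[e f] _ /=; rewrite /h !ncM nc_conj nc_real ger0_norm//.
    rewrite mulrAC ler_wpM2r// ler_pM ?nc_ge0//; apply: l2_le_point; exact: l2_le_norm.
  by rewrite -mulr_sumr ler_wpM2l ?mulr_ge0 ?KW.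
have := csum_fubini ha => fub.
transitivity (csum (fun f => csum (fun e => h e f))).
  rewrite /inner; congr csum; apply/funext => f; rewrite /kernel_op mulrC -csumZ.
    by congr csum; apply/funext => e; rewrite mulrC.
  exact: (kernel_asum K0 KW).
rewrite -fub /inner; congr csum; apply/funext => e.
rewrite /kernel_op -csum_conj; last first.
  exact: (@kernel_asum _ _ (fun e f => K f e) W K0' transpose_le).
rewrite -csumZ; last first.
  have [M' hM'] := @kernel_asum _ _ (fun e f => K f e) W K0' transpose_le _ e h2.
  by exists M'; apply: le_bsum hM' => f; rewrite nc_conj.
congr csum; apply/funext => f.
rewrite rmorphM /h -mulrA mulrC [(K e f)%:C * _]mulrC [RHS]mulrC; congr (_ * _ * _).
exact/esym/conjc_real.
Qed.

End KernelAdjoint.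

(** * The square root of T^* T by iteration *)

Section SquareRoot.
Context {R : realType} {E : choiceType}.
Variables (T B : operator R E) (w1 : R).
Hypothesis w1_gt0 : 0 < w1.
Hypothesis linT : l2_linear T.
Hypothesis linBop : l2_linear B.
Hypothesis bndT : l2_bounded T w1.
Hypothesis bndB : l2_bounded B w1.
Hypothesis adjTB : l2_adjoint T B.

Let v : R := (w1 ^+ 2)^-1.
Let v_ge0 : 0 <= v. Proof. by rewrite invr_ge0 sqr_ge0. Qed.

Definition defect : operator R E := fun phi e => (- v)%:C * B (T phi) e + phi e.

Let l2T phi : l2 phi -> l2 (T phi). Proof. exact: bnd_l2 bndT. Qed.
Let l2Bop phi : l2 phi -> l2 (B phi). Proof. exact: bnd_l2 bndB. Qed.

Lemma l2_defect phi : l2 phi -> l2 (defect phi).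
Proof. by move=> h; apply: l2_lin => //; apply/l2Bop/l2T. Qed.

Lemma lin_defect : l2_linear defect.
Proof.
move=> a phi psi h1 h2; apply/funext => e; have [hT1 hT2] := (l2T h1, l2T h2).
by rewrite /defect linT// linBop//; ring.
Qed.

Lemma adj_defect : l2_adjoint defect defect.
Proof.
move=> phi psi h1 h2; have [l1 l2'] := (l2Bop (l2T h1), l2Bop (l2T h2)).
rewrite inner_linl// inner_linr// conjc_real; congr (_ * _ + _).
have [hT1 hT2] := (l2T h1, l2T h2).
by rewrite (adj_sym bndT bndB adjTB)// adjTB.
Qed.

(** With D = [defect], expanding the square gives |D phi|^2 = |phi|^2 - 2 v |T phi|^2 + v^2 |B T
    phi|^2. As v w1^2 = 1, the last term is at most v |T phi|^2. *)
Lemma bnd_defect : l2_bounded defect 1.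
Proof.
move=> phi N hN; rewrite mul1r; have h := l2_le_l2 hN.
apply: l2_le_mono (l2_le_norm (l2_defect h)) _.
apply: le_trans (norm_le hN).
rewrite -(ler_pXn2r (n := 2)) ?nnegrE ?l2_norm_ge0//.
have hB := l2Bop (l2T h).
have e1 : inner phi (B (T phi)) = (l2_norm (T phi) ^+ 2)%:C.
  by have hT := l2T h; rewrite -adjTB// inner_self.
have e2 : inner (B (T phi)) phi = (l2_norm (T phi) ^+ 2)%:C.
  by rewrite innerC// e1 conjc_real.
have -> : l2_norm (defect phi) ^+ 2 = v ^+ 2 * l2_norm (B (T phi)) ^+ 2
    - 2 * v * l2_norm (T phi) ^+ 2 + l2_norm phi ^+ 2.
  apply: (@real_complex_inj R); rewrite -inner_self; last exact: l2_defect.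
  rewrite inner_linl//; last exact: l2_defect.
  rewrite !inner_linr// !conjc_real e1 e2 !inner_self//.
  by ring.
have hBT : l2_norm (B (T phi)) ^+ 2 <= w1 ^+ 2 * l2_norm (T phi) ^+ 2.
  have bn : l2_norm (B (T phi)) <= w1 * l2_norm (T phi).
    by apply: norm_le; apply: bndB; apply: l2_le_norm; exact: l2T.
  by rewrite -exprMn lerXn2r ?nnegrE ?l2_norm_ge0// mulr_ge0 ?l2_norm_ge0// ltW.
have : v ^+ 2 * l2_norm (B (T phi)) ^+ 2 <= v * l2_norm (T phi) ^+ 2.
  apply: le_trans (ler_wpM2l (sqr_ge0 v) hBT) _.
  have vw : v * w1 ^+ 2 = 1 by rewrite mulVf// sqrf_eq0 gt_eqF.
  have -> : v ^+ 2 * (w1 ^+ 2 * l2_norm (T phi) ^+ 2) =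
      v * w1 ^+ 2 * (v * l2_norm (T phi) ^+ 2) by ring.
  by rewrite vw mul1r.
have : 0 <= v * l2_norm (T phi) ^+ 2 by rewrite mulr_ge0 ?sqr_ge0.
lra.
Qed.

(** A fixed point of Y = (D + Y^2) / 2 with D = [defect] satisfies (1 - Y)^2 = 1 - D = T^* T / w1^2,
    so that w1 (1 - Y) squares to T^* T. *)
Fixpoint sqrt_iter n : operator R E :=
  if n is m.+1 then
    fun phi e => 2^-1 * (defect phi e + sqrt_iter m (sqrt_iter m phi) e)
  else fun _ _ => 0.

(* The iteration run on the scalar 1, whose increments dominate in norm those of
   [sqrt_iter]. *)
Fixpoint sqrt_bound n : R :=
  if n is m.+1 then 2^-1 * (1 + sqrt_bound m ^+ 2) else 0.

Local Notation Y := sqrt_iter.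
Local Notation y := sqrt_bound.

Lemma sqrt_bound_01 n : 0 <= y n <= 1.
Proof.
elim: n => [|n /andP[h0 h1]] /=; first by rewrite lexx ler01.
have : y n ^+ 2 <= 1 by rewrite exprn_ile1.
have := sqr_ge0 (y n); lra.
Qed.

Lemma sqrt_bound_le1 n : y n <= 1. Proof. by have /andP[] := sqrt_bound_01 n. Qed.

Lemma sqrt_bound_incr n : y n <= y n.+1.
Proof.
have h : y n.+1 - y n = 2^-1 * (1 - y n) ^+ 2 by rewrite /=; field.
by rewrite -subr_ge0 h mulr_ge0 ?sqr_ge0 ?invr_ge0.
Qed.

Let nc_half : nc (2^-1 : R[i]) = 2^-1. Proof. by rewrite ncV nc_nat. Qed.

Lemma bnd_iter n : l2_bounded (Y n) (y n).
Proof.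
elim: n => [|n IH] phi N hN /=; first by apply: l2_le0; rewrite mul0r.
have h := l2_leZ 2^-1 (l2_leD (bnd_defect hN) (IH _ _ (IH _ _ hN))).
by apply: l2_le_mono h _; rewrite nc_half le_eqVlt; apply/orP; left; apply/eqP; ring.
Qed.

Lemma l2_iter n phi : l2 phi -> l2 (Y n phi).
Proof. exact: bnd_l2 (@bnd_iter n). Qed.

Lemma lin_iter n : l2_linear (Y n).
Proof.
elim: n => [|n IH] a phi psi h1 h2; apply/funext => e /=.
  by rewrite mulr0 addr0.
by rewrite lin_defect// IH// IH ?l2_iter//; [ring|exact: l2_iter|exact: l2_iter].
Qed.

Lemma iterS n phi e :
  Y n.+1 phi e = 2^-1 * (defect phi e + Y n (Y n phi) e).
Proof. by []. Qed.

Lemma boundS n : y n.+1 = 2^-1 * (1 + y n ^+ 2).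
Proof. by []. Qed.

Lemma adj_iter n : l2_adjoint (Y n) (Y n).
Proof.
elim: n => [|n IH] phi psi h1 h2; first by rewrite /= inner0l inner0r.
have [d1 d2] := (l2_defect h1, l2_defect h2).
have [y1 y2] := (l2_iter n h1, l2_iter n h2).
have [yy1 yy2] := (l2_iter n y1, l2_iter n y2).
have halfC : (2^-1 : R[i]) = (2^-1)%:C by rewrite fmorphV rmorph_nat.
have YE (phi0 : E -> R[i]) : Y n.+1 phi0 =
    fun e => (2^-1)%:C * (defect phi0 e + Y n (Y n phi0) e).
  by apply/funext => e; rewrite iterS halfC.
have [s1 s2] := (l2D d1 yy1, l2D d2 yy2).
by rewrite !YE innerZl// innerZr// innerDl// innerDr// adj_defect// IH// IH.
Qed.

(** The difference of the squares of Y_(n+1) and Y_n is Y_(n+1) (Y_(n+1) - Y_n) + (Y_(n+1) - Y_n)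
    Y_n, without any commutation. The same splitting for the scalars y gives exactly the next
    increment. *)
Lemma iter_step n phi N : l2_le phi N ->
  l2_le (fun e => Y n.+1 phi e - Y n phi e) ((y n.+1 - y n) * N).
Proof.
elim: n phi N => [|n IH] phi N hN.
  apply: eq_l2_le (_ : l2_le (Y 1 phi) _) => [e|]; first by rewrite /= subr0.
  by rewrite [y 0]/= subr0; exact: bnd_iter.
have l := l2_le_l2 hN; have [l1 l2'] := (l2_iter n.+1 l, l2_iter n l).
have h1 := bnd_iter n.+1 (IH _ _ hN).
have h2 := IH _ _ (bnd_iter n hN).
have h := l2_leZ 2^-1 (l2_leD h1 h2).
rewrite (linB (@lin_iter n.+1) l1 l2') in h.
apply: (@eq_l2_le _ _ _ _ _ _ (l2_le_mono h _)).
  by move=> e; rewrite (iterS n.+1 phi e) (iterS n phi e); ring.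
by rewrite nc_half le_eqVlt; apply/orP; left; apply/eqP; rewrite !boundS; field.
Qed.

Lemma iter_steps n k phi N : l2_le phi N ->
  l2_le (fun e => Y (n + k) phi e - Y n phi e) ((y (n + k) - y n) * N).
Proof.
move=> hN; have [N0 _] := hN; elim: k => [|k IH].
  apply: (@eq_l2_le _ _ (fun=> 0)) => [e|]; first by rewrite addn0 subrr.
  by rewrite addn0 subrr mul0r; exact: l2_le0.
rewrite addnS.
apply: (@eq_l2_le _ _ _ _ _ _ (l2_le_mono (l2_leD (iter_step (n + k) hN) IH) _)).
  by move=> e /=; rewrite addrA subrK.
by rewrite le_eqVlt; apply/orP; left; apply/eqP; ring.
Qed.

(** The pointwise limit of the iterates as a telescoping series, which starts at [Y 0] = 0. It
    converges absolutely because the scalar increments sum to at most 1. *)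
Definition sqrt_lim : operator R E :=
  fun phi e => csum (fun n : nat => Y n.+1 phi e - Y n phi e).

Local Notation L := sqrt_lim.

Lemma iter_cvg phi e : l2 phi -> cvgc \oo (fun n => Y n phi e) (L phi e).
Proof.
move=> /l2_le_norm h.
have a : asum (fun n : nat => Y n.+1 phi e - Y n phi e).
  exists (l2_norm phi) => s us; pose m := (\max_(i <- s) i).+1.
  apply: (@le_trans _ _ (\sum_(n <- s) (y n.+1 - y n) * l2_norm phi)).
    by apply: ler_sum => n _; exact: l2_le_point (iter_step n h).
  rewrite -mulr_suml ler_piMl ?l2_norm_ge0//.
  apply: (@le_trans _ _ (\sum_(n <- iota 0 m) (y n.+1 - y n))).
    apply: ler_sum_sub => //; first exact: iota_uniq.
      by move=> i si; rewrite mem_iota ltnS; exact: leq_bigmax_seq.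
    by move=> i; rewrite subr_ge0 sqrt_bound_incr.
  have -> : iota 0 m = index_iota 0 m by rewrite /index_iota subn0.
  by rewrite telescope_sumr// subr0; exact: sqrt_bound_le1.
have := has_sum_series (asum_has_sum a) => /cvgcP; apply: eq_cvgc => n.
by rewrite telescope_sumr//= subr0.
Qed.

Lemma bnd_lim : l2_bounded L 1.
Proof.
move=> phi N hN; have [N0 _] := hN.
apply: (@l2_le_lim _ _ _ \oo _ (fun n => Y n phi)) => [e|n].
  exact: iter_cvg (l2_le_l2 hN).
by apply: l2_le_mono (bnd_iter n hN) _; rewrite ler_wpM2r// sqrt_bound_le1.
Qed.

Lemma l2_lim phi : l2 phi -> l2 (L phi).
Proof. exact: bnd_l2 bnd_lim. Qed.

Lemma lin_lim : l2_linear L.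
Proof.
move=> a phi psi h1 h2; apply/funext => e.
have hl := l2_lin a h1 h2.
have h3 : cvgc \oo (fun n => a * Y n phi e + Y n psi e) (a * L phi e + L psi e).
  by apply: cvgcD; [apply: cvgcZ|]; exact: iter_cvg.
have h4 : cvgc \oo (fun n => a * Y n phi e + Y n psi e)
    (L (fun e => a * phi e + psi e) e).
  by apply: eq_cvgc (iter_cvg e hl) => n; rewrite lin_iter.
exact: (cvgc_unique h4 h3).
Qed.

Let ysup : R := sup (range y).

Let y_ub : has_ubound (range y).
Proof. by exists 1 => _ [n _ <-]; exact: sqrt_bound_le1. Qed.

Let y_le n : y n <= ysup.
Proof. by apply: ub_le_sup => //; exists n. Qed.

(** Convergence in operator norm, at a rate read off from the scalar iteration; self-adjointness and
    the fixed-point equation pass to the limit through it. *)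
Lemma lim_near phi N n : l2_le phi N ->
  l2_le (fun e => L phi e - Y n phi e) ((ysup - y n) * N).
Proof.
move=> hN; have [N0 _] := hN; have l := l2_le_l2 hN.
apply: (@l2_le_lim _ _ _ \oo _ (fun k e => Y (n + k) phi e - Y n phi e)) => [e|k].
  apply: cvgcD; last exact: cvgc_cst.
  move=> d d0; have [m _ hm] := iter_cvg e l d0; exists m => // k /= mk.
  by apply: hm; rewrite /= (leq_trans mk)// leq_addl.
by apply: l2_le_mono (iter_steps n k hN) _; rewrite ler_wpM2r// lerB.
Qed.

Lemma ysup_near (d : R) : 0 < d -> exists n, ysup - y n < d.
Proof.
move=> d0; have e0 : range y !=set0 by exists (y 0); exists 0%N.
have [_ [n _ <-] h] := sup_adherent d0 (conj e0 y_ub).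
by exists n; rewrite ltrBlDr addrC -ltrBlDr.
Qed.

Lemma adj_lim : l2_adjoint L L.
Proof.
move=> phi psi h1 h2; apply/eqP; rewrite -subr_eq0; apply/eqP/nc_near_eq0 => d d0.
have [N hN] : exists N, l2_le phi N /\ l2_le psi N.
  exists (Num.max (l2_norm phi) (l2_norm psi)); split.
    by apply: l2_le_mono (l2_le_norm h1) _; rewrite le_max lexx.
  by apply: l2_le_mono (l2_le_norm h2) _; rewrite le_max lexx orbT.
have [hp hq] := hN; have [N0 _] := hp.
(* Two inner products, each at most [(ysup - y n) * N * N]; adding 1 keeps the denominator
   positive. *)
have c0 : 0 < d / (2 * N * N + 1).
  by rewrite divr_gt0// ltr_wpDl// !mulr_ge0.
have [n hn] := ysup_near c0.
have -> : inner (L phi) psi - inner phi (L psi) =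
    inner (fun e => L phi e - Y n phi e) psi - inner phi (fun e => L psi e - Y n psi e).
  have [l1 l2'] := (l2_lim h1, l2_lim h2); have [y1 y2] := (l2_iter n h1, l2_iter n h2).
  by rewrite innerBl// innerBr// adj_iter//; ring.
apply: le_trans (ncB _ _) _.
have b1 := inner_le (lim_near n hp) hq.
have b2 := inner_le hp (lim_near n hq).
apply: (@le_trans _ _ ((ysup - y n) * (2 * N * N + 1))); last first.
  by rewrite -ler_pdivlMr ?ltr_wpDl ?mulr_ge0// ltW.
have yn : 0 <= ysup - y n by rewrite subr_ge0 y_le.
have := lerD b1 b2; nra.
Qed.

Lemma lim_fixpoint phi e : l2 phi ->
  L phi e = 2^-1 * (defect phi e + L (L phi) e).
Proof.
move=> h; apply/eqP; rewrite -subr_eq0; apply/eqP/nc_near_eq0 => d d0.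
have hN := l2_le_norm h; set N := l2_norm phi in hN; have [N0 _] := hN.
have c0 : 0 < d / (2 * N + 1) by rewrite divr_gt0// ltr_wpDl// mulr_ge0.
have [n hn] := ysup_near c0.
have l1 := l2_lim h; have l2' := l2_iter n h.
(* Each of the three differences is at most [(ysup - y n) * N], and two of them are halved: in total
   2 N times the rate. *)
have -> : L phi e - 2^-1 * (defect phi e + L (L phi) e) =
   (L phi e - Y n.+1 phi e) -
   2^-1 * ((L (L phi) e - Y n (L phi) e) + (Y n (L phi) e - Y n (Y n phi) e)).
  by rewrite iterS; ring.
have b1 := l2_le_point e (lim_near n.+1 hN).
have b2 := l2_le_point e (lim_near n (bnd_lim hN)).
have b3 := l2_le_point e (bnd_iter n (lim_near n hN)).
rewrite (linB (@lin_iter n) l1 l2') in b3.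
have yn : 0 <= ysup - y n by rewrite subr_ge0 y_le.
apply: (@le_trans _ _ ((ysup - y n) * (2 * N + 1))); last first.
  by rewrite -ler_pdivlMr ?ltr_wpDl ?mulr_ge0// ltW.
apply: le_trans (ncB _ _) _; rewrite ncM nc_half.
have b4 := ncD (L (L phi) e - Y n (L phi) e) (Y n (L phi) e - Y n (Y n phi) e).
have b3' : nc (Y n (L phi) e - Y n (Y n phi) e) <= (ysup - y n) * N.
  apply: le_trans b3 _; rewrite ler_piMl ?mulr_ge0 ?sqrt_bound_le1//.
have b1' : nc (L phi e - Y n.+1 phi e) <= (ysup - y n) * N.
  by apply: le_trans b1 _; rewrite ler_wpM2r// lerB// sqrt_bound_incr.
rewrite mul1r in b2; nra.
Qed.

Definition abs_op : operator R E := fun phi e => w1%:C * (phi e - L phi e).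

Lemma lin_abs : l2_linear abs_op.
Proof.
move=> a phi psi h1 h2; apply/funext => e; rewrite /abs_op lin_lim//.
by ring.
Qed.

Lemma bnd_abs : l2_bounded abs_op (w1 * 2).
Proof.
move=> phi N hN; have h := l2_leZ w1%:C (l2_leB hN (bnd_lim hN)).
have e : nc w1%:C * (N + 1 * N) = w1 * 2 * N.
  by rewrite nc_real ger0_norm ?ltW//; ring.
by rewrite e in h.
Qed.

Lemma abs_square phi : l2 phi -> abs_op (abs_op phi) = B (T phi).
Proof.
move=> h; have l1 := l2_lim h.
have l2' : l2 (fun e => phi e - L phi e) := l2B h l1.
have l0 : l2 (fun _ : E => 0 : R[i]) by apply: (@l2_le_l2 _ _ _ 0); exact: l2_le0.
have L0 : L (fun _ : E => 0 : R[i]) = fun=> 0.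
  have := linB lin_lim l0 l0; rewrite /= (_ : (fun _ => 0 - 0) = fun=> 0).
    by move=> ->; apply/funext => e; rewrite subrr.
  by apply/funext => e; rewrite subrr.
(* The summand 0 brings the expression into the form to which [lin_lim] applies. *)
have aE : abs_op phi = fun e => w1%:C * (phi e - L phi e) + 0.
  by apply/funext => e; rewrite addr0.
apply/funext => e; rewrite {1}/abs_op.
have -> : L (abs_op phi) e = w1%:C * (L phi e - L (L phi) e).
  by rewrite aE lin_lim// L0 addr0 linB//; exact: lin_lim.
have fx := lim_fixpoint e h.
(* Hence 1 - 2 L + L^2 becomes 1 - D, that is, T^* T / w1^2. *)
have -> : L (L phi) e = 2 * L phi e - defect phi e by rewrite [in RHS]fx; field.
have vE : (v)%:C * (w1%:C * w1%:C) = 1 :> R[i].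
  by rewrite -!rmorphM /= -expr2 mulVf ?rmorph1// sqrf_eq0 gt_eqF.
rewrite /abs_op /defect rmorphN /=.
transitivity ((v)%:C * (w1%:C * w1%:C) * B (T phi) e); first by ring.
by rewrite vE mul1r.
Qed.

Lemma adj_abs : l2_adjoint abs_op abs_op.
Proof.
move=> phi psi h1 h2; have [l1 l2'] := (l2_lim h1, l2_lim h2).
have [b1 b2] := (l2B h1 l1, l2B h2 l2').
by rewrite innerZl// innerZr// innerBl// innerBr// adj_lim.
Qed.

(** Self-adjointness makes <L phi, phi> real, and the bound 1 on L makes it at most |phi|^2. *)
Lemma abs_ge0 phi : l2 phi -> 0 <= inner (abs_op phi) phi.
Proof.
move=> h; have l := l2_lim h; have hN := l2_le_norm h; have b := l2B h l.
rewrite innerZl// innerBl// inner_self//.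
have re : (inner (L phi) phi)^*%C = inner (L phi) phi.
  by rewrite -innerC// adj_lim.
have im : complex.Im (inner (L phi) phi) = 0.
  move: re; case: (inner _ _) => x z /= [] /eqP; rewrite eq_sym -subr_eq0 opprK.
  by rewrite -mulr2n mulrn_eq0 /= => /eqP.
have le1 : complex.Re (inner (L phi) phi) <= l2_norm phi ^+ 2.
  apply: le_trans (ler_norm _) _; apply: le_trans (nc_ge_Re _) _.
  by have := inner_le (bnd_lim hN) hN; rewrite mul1r expr2.
have -> : inner (L phi) phi = (complex.Re (inner (L phi) phi))%:C.
  by move: im; case: (inner _ _) => x z /= ->.
by rewrite -rmorphB -rmorphM ler0c mulr_ge0 ?subr_ge0// ltW.
Qed.

Lemma abs_norm phi : l2 phi -> l2_norm (abs_op phi) = l2_norm (T phi).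
Proof.
move=> h; have hT := l2T h; have la := bnd_l2 bnd_abs h.
have e : (l2_norm (abs_op phi) ^+ 2)%:C = (l2_norm (T phi) ^+ 2)%:C :> R[i].
  rewrite -inner_self// -inner_self// adj_abs// abs_square// -adjTB//.
by have /real_complex_inj/eqP := e; rewrite eqrXn2 ?l2_norm_ge0// => /eqP.
Qed.

Lemma abs_absolute_value : is_absolute_value T abs_op.
Proof.
split; first by split; [exact: bounded_operatorP lin_abs bnd_abs|exact: abs_ge0].
exists B; split; last exact: abs_square.
by split; [exact: bounded_operatorP linBop bndB|exact: adjTB].
Qed.

End SquareRoot.

(** * The Bass operator and the Euler product *)

Section BassTraceClass.
Context {R : realType} {X : oriented_graph}.
Local Notation E := (edge X).
Variables (w : E -> E -> R) (W : R).
Hypothesis w0 : forall e f, 0 <= w e f.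
Hypothesis wW : forall s : seq (E * E), uniq s -> \sum_(p <- s) w p.1 p.2 <= W.

Let row_le e (s : seq E) : uniq s -> \sum_(f <- s) w e f <= W.
Proof.
move=> us; have := @kernel_rect_le _ _ w W wW [:: e] s isT us.
by rewrite big_seq1.
Qed.

Definition row_sum e : R := complex.Re (csum (fun f => (w e f)%:C : R[i])).

Lemma row_sumP e : [/\ has_sum (fun f => (w e f)%:C) (row_sum e)%:C,
  0 <= row_sum e & forall s : seq E, uniq s -> \sum_(f <- s) w e f <= row_sum e].
Proof.
have [t [tE ht tmax]] := nonneg_csum (w0 e) (@row_le e).
rewrite /row_sum tE /=; split=> //.
by have := tmax [::] isT; rewrite big_nil.
Qed.

Lemma sum_row_sum_le (s : seq E) : uniq s -> \sum_(e <- s) row_sum e <= W.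
Proof.
move=> us; have r0 e : 0 <= row_sum e by have [] := row_sumP e.
have h e : has_sum (fun f => (w e f)%:C) (row_sum e)%:C by have [] := row_sumP e.
have /has_sum_le := has_sum_big s h; rewrite -rmorph_sum nc_real ger0_norm ?sumr_ge0//.
move=> hb; apply: hb => t ut.
under eq_bigr do rewrite -rmorph_sum nc_real ger0_norm ?sumr_ge0//.
by rewrite exchange_big; apply: (@kernel_rect_le _ _ w W wW).
Qed.

Lemma l2_le_bass_basis e : l2_le (bass_operator w (basis_vec R e)) (row_sum e).
Proof.
have [_ r0 hr] := row_sumP e; split=> // s us.
under eq_bigr do rewrite bass_operator_basis nc_real ger0_norm//.
apply: le_trans (sum_sqr_le _ _) _; first by move=> f.
by rewrite lerXn2r ?nnegrE ?sumr_ge0 ?hr.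
Qed.

Lemma bass_trace_class : trace_class (bass_operator w).
Proof.
have W0 : 0 <= W by have := @wW [::] isT; rewrite big_nil.
(* The square root construction divides by the square of its bound, and W may be 0. *)
have W1 : 0 < W + 1 by rewrite ltr_wpDl.
have widen (A : operator R E) : l2_bounded A W -> l2_bounded A (W + 1).
  move=> h phi N hN; have [N0 _] := hN.
  by apply: l2_le_mono (h _ _ hN) _; rewrite ler_wpM2r// lerDl.
have w0' e f : 0 <= w f e by [].
pose B : operator R E := kernel_op (fun e f => w f e).
have lT : l2_linear (bass_operator w) := kernel_lin w0 wW.
have lB : l2_linear B := @kernel_lin _ _ (fun e f => w f e) W w0' (transpose_le wW).
have bT : l2_bounded (bass_operator w) (W + 1) := widen _ (kernel_bnd w0 wW).
have bB : l2_bounded B (W + 1) :=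
  widen _ (@kernel_bnd _ _ (fun e f => w f e) W w0' (transpose_le wW)).
have aTB : l2_adjoint (bass_operator w) B := kernel_adj w0 wW.
split; first exact: bounded_operatorP lT bT.
exists (abs_op (bass_operator w) B (W + 1)); split.
  exact: abs_absolute_value.
eexists; apply: asum_has_sum; exists W => s us.
apply: le_trans (sum_row_sum_le us); apply: ler_sum => e _; rewrite inner_basis.
have le : l2 (basis_vec R e) := l2_le_l2 (l2_le_basis e).
have lS := bnd_l2 (bnd_abs W1 lT lB bT bB aTB) le.
apply: le_trans (l2_le_point e (l2_le_norm lS)) _.
by rewrite abs_norm//; apply: norm_le; exact: l2_le_bass_basis.
Qed.

End BassTraceClass.

(** * Convergence of the product over primitive cycles *)

Section EulerProduct.
Context {R : realType} {X : oriented_graph}.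
Local Notation E := (edge X).
Variables (w : E -> E -> R) (W : R).
Hypothesis w0 : forall e f, 0 <= w e f.
Hypothesis w_adj : forall e f, w e f != 0 -> target e = source f.
Hypothesis wW : forall s : seq (E * E), uniq s -> \sum_(p <- s) w p.1 p.2 <= W.

Let a (c : primitive_cycles X) : R[i] := (cycle_weight w (val c))%:C.
Let l (c : primitive_cycles X) : nat := cycle_length (val c).
Let W0 : 0 <= W := W_ge0 wW.

Let l_gt0 c : (0 < l c)%N. Proof. exact: size_closed_path. Qed.

Lemma power_sum_cycle (A : {fset primitive_cycles X}) k :
  power_sum a l A k = (cycle_power_sum w k A)%:C.
Proof.
rewrite /power_sum /cycle_power_sum rmorph_sum; apply: eq_bigr => c _.
by rewrite rmorphM rmorph_nat rmorphXn.
Qed.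

Lemma power_sum_windows (x0 : E) (A : {fset primitive_cycles X}) k :
  power_sum a l A k.+1 = \sum_(s <- windows x0 k.+1 A) pweight w s.
Proof. by rewrite power_sum_cycle (cycle_power_sumE w x0)// rmorph_sum. Qed.

Let power_sum0 k : power_sum a l (fset0 : {fset primitive_cycles X}) k = 0.
Proof. by rewrite /power_sum big_seq_cond big1// => c; rewrite in_fset0. Qed.

(** Periodic words require a default edge, and any primitive cycle supplies one. *)
Let cycle_edge (c : primitive_cycles X) : exists x : E, True.
Proof.
by have := l_gt0 c; rewrite /l /cycle_length; case: (val _) => // x ? _; exists x.
Qed.

Lemma power_sum_bound (A : {fset primitive_cycles X}) k :
  nc (power_sum a l A k.+1) <= W ^+ k.+1.
Proof.
have [->|[c _]] := fset_0Vmem A.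
  by rewrite power_sum0 nc0 exprn_ge0.
have [x0 _] := cycle_edge c; rewrite (power_sum_windows x0).
apply: le_trans (nc_sum _ _ _) _; apply: (pweight_bsum w0 wW).
exact: windows_uniq.
Qed.

Lemma power_sum_cvg k :
  cvgc totally (fun A : {fset primitive_cycles X} => power_sum a l A k.+1)
    (trace_total w k.+1).
Proof.
have /has_sumP hs := trace_total_has_sum w0 wW (k := k.+1).
(* Without edges there are neither primitive cycles nor tuples of length k+1, so both sides are
   0. *)
have [[x0 _]|noE] := pselect (exists x : E, True); last first.
  move=> e /hs[G0 hG0]; exists fset0 => // A _ /=.
  have := hG0 G0 (fsubset_refl _).
  have [-> |[s _]] := fset_0Vmem G0; last by case: noE; exists (thead s).
  have [-> |[c _]] := fset_0Vmem A; last by case: noE; exact: cycle_edge c.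
  by rewrite power_sum0 big_seq_fset0.
pose P (s : k.+1.-tuple E) c := forall A : {fset primitive_cycles X},
  c \in A -> s \in windows x0 k.+1 A.
(* The value is an option because a tuple of weight 0 need not be a closed path, and then has no
   primitive root. *)
have [root hroot] : exists root : k.+1.-tuple E -> option (primitive_cycles X),
    forall s : k.+1.-tuple E, path_weight w s != 0 ->
      exists2 c, root s = Some c & P s c.
  have h (s : k.+1.-tuple E) : exists o : option (primitive_cycles X),
      path_weight w s != 0 -> exists2 c, o = Some c & P s c.
    have [z|nz] := eqVneq (path_weight w s) 0; first by exists None.
    have [c hc] := windows_cover x0 w_adj (ltn0Sn k) nz.
    by exists (Some c) => _; exists c.
  by have [root hr] := choice h; exists root.
move=> e /hs[G0 hG0]; exists [fset c in pmap root G0]%fset => // A /= GA.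
rewrite (power_sum_windows x0).
(* Since A contains the roots of all tuples of nonzero weight in G0, the tuples of G0 missing from
   the windows have weight 0 and can be added. *)
have <- : \sum_(s <- ([fset x in windows x0 k.+1 A] `|` G0)%fset) pweight w s =
    \sum_(s <- windows x0 k.+1 A) pweight w s.
  rewrite -(@big_fset_incl _ _ _ _ [fset x in windows x0 k.+1 A]%fset) /=.
  - apply: perm_big; apply: uniq_perm; rewrite ?fset_uniq ?windows_uniq// => s.
    by rewrite !inE.
  - exact: fsubsetUl.
  - move=> s; rewrite !inE => /orP[-> //|sG] sW; rewrite /pweight.
    have [-> //|nz] := eqVneq (path_weight w s) 0.
    have [c rc Pc] := hroot _ nz; move: sW; rewrite Pc//.
    apply: (fsubsetP GA); rewrite !inE mem_pmap; apply/mapP; exists s => //.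
by apply: hG0; exact: fsubsetUr.
Qed.

Lemma euler_poly_horner (A : {fset primitive_cycles X}) u :
  (euler_poly a l A).[u] = \prod_(c <- A) (1 - a c * u ^+ l c).
Proof.
rewrite /euler_poly horner_prod; apply: eq_bigr => c _.
by rewrite !hornerE.
Qed.

Lemma euler_product_cvg u : W * nc u < 1 ->
  cvgc totally (fun A : {fset primitive_cycles X} =>
    \prod_(c <- A) (1 - a c * u ^+ l c)) (psum (fredholm_coef w) u).
Proof.
move=> Wu; have ls (A : {fset primitive_cycles X}) c : c \in enum_fset A -> (0 < l c)%N.
  by move=> _; exact: l_gt0.
have h : cvgc totally (fun A : {fset primitive_cycles X} =>
    psum (fun n => (euler_poly a l A)`_n) u) (psum (fredholm_coef w) u).
  apply: (@tannery _ _ _ _ _ _ W) => //.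
  - move=> A; apply: (@newton_bound _ _ (power_sum a l A)) => //.
    + by apply: euler_poly0; exact: ls.
    + by move=> k; exact: power_sum_bound.
    + by move=> n; apply: euler_poly_newton; exact: ls.
  - exact: fredholm_coef_geometric.
  - apply: (@newton_cvg _ _ totally _
      (fun (A : {fset primitive_cycles X}) n => (euler_poly a l A)`_n)
      (fun A k => power_sum a l A k) (fredholm_coef w) (trace_total w)).
    + by move=> A; apply: euler_poly0; exact: ls.
    + exact: fredholm_coef0.
    + exact: power_sum_cvg.
    + by move=> A n; apply: euler_poly_newton; exact: ls.
    + exact: fredholm_coef_newton wW.
by apply: eq_cvgc h => A; rewrite psum_poly euler_poly_horner.
Qed.

Lemma euler_factor_neq0 u c : W * nc u < 1 -> 1 - a c * u ^+ l c != 0.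
Proof.
move=> Wu; rewrite subr_eq0; apply/eqP => e1.
have lt : nc (a c * u ^+ l c) < 1.
  (* The representative of c is a single l(c)-tuple, so its weight is one term of a sum bounded by
     W^l(c). *)
  have ac : nc (a c) <= W ^+ l c.
    have := @pweight_bsum _ _ w W w0 wW (l c) => /bsum1.
    by move=> /(_ (in_tuple (val (cycle_rep (val c))))).
  apply: (@le_lt_trans _ _ ((W * nc u) ^+ l c)).
    by rewrite ncM ncX exprMn ler_wpM2r ?exprn_ge0 ?nc_ge0.
  by rewrite exprn_ilt1 ?mulr_ge0 ?nc_ge0// -lt0n l_gt0.
by move: lt; rewrite -e1 nc1 ltxx.
Qed.

Lemma fredholm_psum_neq0 u : W * nc u < 2^-1 -> psum (fredholm_coef w) u != 0.
Proof.
move=> Wu; set q := W * nc u in Wu.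
have q0 : 0 <= q by rewrite mulr_ge0 ?nc_ge0.
have q01 : 0 <= q < 1 by rewrite q0 (lt_trans Wu)// invf_lt1 ?ltr1n.
have ec := fredholm_coef_entire w0 wW.
rewrite (psumS u ec) (fredholm_coef0 w) addr_eq0; apply/eqP => e1.
(* The series is 1 plus a remainder of modulus at most q / (1 - q), which is less than 1 because q <
   1/2. *)
have b : bsum (fun n => fredholm_coef w n.+1 * u ^+ n) (W * (1 - q)^-1).
  move=> s us; apply: le_trans (ler_wpM2l W0 (geometric_sum_le q01 us)).
  rewrite mulr_sumr; apply: ler_sum => n _; rewrite ncM ncX exprMn mulrA -exprS.
  by rewrite ler_wpM2r ?exprn_ge0 ?nc_ge0//; exact: fredholm_coef_geometric.
have := csum_le b; rewrite -/(psum _ _) => h.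
have : nc (1 : R[i]) <= nc u * (W * (1 - q)^-1).
  by rewrite [X in nc X]e1 ncN ncM ler_wpM2l ?nc_ge0.
rewrite nc1 mulrA [nc u * W]mulrC -/q ler_pdivlMr ?subr_gt0; last by case/andP: q01.
by lra.
Qed.

End EulerProduct.

(* At a pole, Z takes the value 0 = 0^-1, so that Z^-1 vanishes there. *)
Theorem theorem2p11 (R : realType) (X : oriented_graph)
    (w : edge X -> edge X -> R)
    (hX : bounded_valency X) (hw : transition_weight w) :
  trace_class (bass_operator w) /\
  exists Z : R[i] -> R[i],
    [/\ exists2 r : R, 0 < r & forall u : R[i], `|u| < r%:C ->
          prod_converges_to (@zeta_factor R X w u) (Z u),
        meromorphic Z,
        entire (fun u => (Z u)^-1) &
        forall u : R[i],
          is_fredholm_det (fun phi e => - u * bass_operator w phi e) (Z u)^-1].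
Proof.
have [w0 w_adj wfin] := hw.
pose W := fine (\esum_(ef in [set: edge X * edge X]) (w ef.1 ef.2)%:E)%E.
have wW (s : seq (edge X * edge X)) : uniq s -> \sum_(p <- s) w p.1 p.2 <= W.
  move=> us; rewrite -lee_fin fineK; last first.
    by rewrite ge0_fin_numE// esum_ge0// => p _; rewrite lee_fin.
  exact: (@esum_ge_sum _ _ (fun p : edge X * edge X => w p.1 p.2)).
have W0 : 0 <= W := W_ge0 wW.
split; first exact: bass_trace_class w0 wW.
have ec := fredholm_coef_entire w0 wW.
exists (fun u => (psum (fredholm_coef w) u)^-1); split.
(* Adding 1 keeps the radius meaningful when W = 0; in every case W |u| < 1/2. *)
- exists (2^-1 / (W + 1)); first by rewrite divr_gt0 ?invr_gt0 ?ltr_wpDl.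
  move=> u; rewrite normr_nc ltcR ltr_pdivlMr ?ltr_wpDl// => hu.
  have Wu2 : W * nc u < 2^-1.
    apply: le_lt_trans hu; rewrite mulrC ler_wpM2l ?nc_ge0// lerDl.
    exact: ler01.
  have Wu : W * nc u < 1 by rewrite (lt_trans Wu2)// invf_lt1 ?ltr1n.
  split.
  + by move=> c; rewrite invr_eq0; exact: (euler_factor_neq0 w0 wW).
  + by rewrite invr_eq0; exact: (fredholm_psum_neq0 w0 wW Wu2).
  + have h : cvgc totally (fun A : {fset primitive_cycles X} =>
        (\prod_(c <- A) (1 - (cycle_weight w (val c))%:C *
          u ^+ cycle_length (val c)))^-1) (psum (fredholm_coef w) u)^-1.
      apply: cvgcV; first exact: (fredholm_psum_neq0 w0 wW Wu2).
      exact: (euler_product_cvg w0 w_adj wW Wu).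
    have {}h : cvgc totally (fun A : {fset primitive_cycles X} =>
        \prod_(c <- A) zeta_factor w u c) (psum (fredholm_coef w) u)^-1.
      by apply: eq_cvgc h => A; rewrite prodfV.
    by move/cvgcP: h.
- by apply: psum_inv_meromorphic => //; rewrite fredholm_coef0 oner_neq0.
(* [psum_holomorphic] is stated for series in u - p; here p = 0. *)
- move=> z; rewrite (_ : (fun u => _) = fun u => psum (fredholm_coef w) (u - 0)).
    exact: psum_holomorphic.
  by apply/funext => u; rewrite invrK subr0.
(* A k x k minor of -uT is (-u)^k times that of T, one factor per row. *)
- move=> u; rewrite invrK; exists (fun k => (- u) ^+ k * minor_total w k); split.
    move=> k; apply: eq_has_sum (has_sumZ _ (minor_total_has_sum w0 wW (k := k))) => s.
    rewrite /minor -detZ; congr (\det _); apply/matrixP => i j; rewrite !mxE.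
    by rewrite inner_basis bass_operator_basis.
  have := has_sum_series (asum_has_sum (entire_coef_asum u ec)).
  rewrite (_ : (fun n => \sum_(0 <= k < n) fredholm_coef w k * u ^+ k) =
    (fun n => \sum_(0 <= k < n) (- u) ^+ k * minor_total w k / k`!%:R))//.
  apply/funext => n; apply: eq_bigr => k _.
  by rewrite /fredholm_coef [(- u) ^+ k]exprNn; ring.
Qed.
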